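(* Let smooth initial data (A) for an A-surface be given, and let $f^\epsilon$ be the corresponding canonical discrete A-surfaces. Then for some $r>0$ the canonical discrete A-surfaces $f^\epsilon:\mathcal{B}^\epsilon(r)\to\mathbb{R}^3$ converge, as $\epsilon\to0$, to the unique A-surface $f:\mathcal{B}(r)\to\mathbb{R}^3$ with the initial data (A), where all surfaces are normalized by the same fixed value $f^\epsilon(0)=f(0)\in\mathbb{R}^3$. The convergence is with the order $O(\epsilon)$ in $C^\infty(\mathcal{B}(r))$.
   Context: Put $\mathcal{B}_1=\mathbb{R}\times\{0\}$, $\mathcal{B}_2=\{0\}\times\mathbb{R}$, $\mathcal{B}(r)=[0,r]^2$, $\mathcal{B}^\epsilon(r)=(\epsilon\mathbb{Z})^2\cap[0,r]^2$, $\mathcal{B}_i^\epsilon=\mathcal{B}_i\cap(\epsilon\mathbb{Z})^2$. On $(\epsilon\mathbb{Z})^2$: $(\tau_i f)(u)=f(u+\epsilon e_i)$, $\delta_i=\epsilon^{-1}(\tau_i-1)$, $\delta^\alpha=\delta_1^{\alpha_1}\delta_2^{\alpha_2}$. An A-surface is a surface $f$ in $\mathbb{R}^3$ parametrized along asymptotic lines ($\partial_1^2f,\partial_2^2f\in\mathrm{span}(\partial_1f,\partial_2f)$). It is described by its Lelieuvre normal field $n$ with values in $\mathbb{R}^3$ through $\partial_1f=\partial_1n\times n$, $\partial_2f=n\times\partial_2n$, where $n$ satisfies the Moutard equation $\partial_1\partial_2n=q_{12}n$; $n$ determines $f$ up to translation. Initial data (A): two smooth curves $n|_{\mathcal{B}_1}$,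 $n|_{\mathcal{B}_2}$ in $\mathbb{R}^3$ with a common point $n(0)$, and a smooth function $q_{12}:\mathbb{R}^2\to\mathbb{R}$. The A-surface with initial data (A) is the one obtained by the Lelieuvre formulas from the solution $n$ of the Moutard equation with these data. Canonical discrete A-surfaces for (A): let $n^\epsilon:(\epsilon\mathbb{Z})^2\to\mathbb{R}^3$ be the solution of $\tau_1\tau_2n^\epsilon+n^\epsilon=a_{12}^\epsilon(\tau_1n^\epsilon+\tau_2n^\epsilon)$ with $n^\epsilon=n$ on $\mathcal{B}_i^\epsilon$ ($i=1,2$) and $a_{12}^\epsilon=1+\frac12\epsilon^2q_{12}$ on $(\epsilon\mathbb{Z})^2$; then $f^\epsilon$ is defined by $\delta_1f^\epsilon=\delta_1n^\epsilon\times n^\epsilon$, $\delta_2f^\epsilon=n^\epsilon\times\delta_2n^\epsilon$. Convergence $f^\epsilon\to f$ with the order $O(\epsilon)$ in $C^\infty(\mathcal{B}(r))$ means: for every multi-index $\alpha$ there is $c_\alpha$ such that $|\delta^\alpha(f^\epsilon-f)(u)|\le c_\alpha\epsilon$ for all sufficiently small $\epsilon>0$ and all $u\in\mathcal{B}^\epsilon(r)$ at which this difference quotient is defined on $\mathcal{B}^\epsilon(r)$. *)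

(* Defs.v *)
From Stdlib Require Import Reals.
From Coquelicot Require Import Coquelicot.
Open Scope R_scope.

(* R^3 as an iterated product: Coquelicot's product norm is the square root of
   the sum of the squared norms, so [norm] below is the Euclidean norm. *)
Definition vec3 : NormedModule R_AbsRing :=
  prod_NormedModule R_AbsRing
    (prod_NormedModule R_AbsRing R_NormedModule R_NormedModule) R_NormedModule.

Definition mkvec (a b c : R) : vec3 := ((a, b), c).
Definition crd1 (v : vec3) : R := fst (fst v).
Definition crd2 (v : vec3) : R := snd (fst v).
Definition crd3 (v : vec3) : R := snd v.

Definition cross (u v : vec3) : vec3 :=
  mkvec (crd2 u * crd3 v - crd3 u * crd2 v)
        (crd3 u * crd1 v - crd1 u * crd3 v)
        (crd1 u * crd2 v - crd2 u * crd1 v).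

Definition in_span (w u v : vec3) : Prop :=
  exists a b : R, w = plus (scal a u) (scal b v).

Definition smooth_R (g : R -> R) : Prop :=
  forall (k : nat) (x : R), ex_derive_n g k x.

Definition smooth_curve (g : R -> vec3) : Prop :=
  smooth_R (fun x => crd1 (g x)) /\
  smooth_R (fun x => crd2 (g x)) /\
  smooth_R (fun x => crd3 (g x)).

(* [ex_diff_n g k x y]: all iterated mixed partial derivatives of [g] of order
   at most [k] exist and are continuous at (x, y). *)
Definition smooth_R2 (g : R -> R -> R) : Prop :=
  forall (k : nat) (x y : R), ex_diff_n g k x y.

Definition smooth_field (g : R -> R -> vec3) : Prop :=
  smooth_R2 (fun x y => crd1 (g x y)) /\
  smooth_R2 (fun x y => crd2 (g x y)) /\
  smooth_R2 (fun x y => crd3 (g x y)).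

Definition partial1 (g : R -> R -> vec3) (x y : R) : vec3 :=
  mkvec (Derive (fun t => crd1 (g t y)) x)
        (Derive (fun t => crd2 (g t y)) x)
        (Derive (fun t => crd3 (g t y)) x).

Definition partial2 (g : R -> R -> vec3) (x y : R) : vec3 :=
  mkvec (Derive (fun t => crd1 (g x t)) y)
        (Derive (fun t => crd2 (g x t)) y)
        (Derive (fun t => crd3 (g x t)) y).

(* The square B(r) = [0,r]^2. *)
Definition in_square (r x y : R) : Prop := 0 <= x <= r /\ 0 <= y <= r.

(* Smooth maps on the closed square B(r) are represented by smooth maps on R^2,
   on which conditions are only imposed at the points of B(r).  The partial
   derivatives at points of B(r) depend only on the restriction to B(r). *)

(* The plane spanned by the two tangent vectors only makes sense where the map
   is an immersion; arbitrary initial data may lead to points where the two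
   tangent vectors are linearly dependent, and nothing is required there. *)
Definition A_surface (r : R) (f : R -> R -> vec3) : Prop :=
  smooth_field f /\
  forall x y, in_square r x y ->
    cross (partial1 f x y) (partial2 f x y) <> zero ->
    in_span (partial1 (partial1 f) x y) (partial1 f x y) (partial2 f x y) /\
    in_span (partial2 (partial2 f) x y) (partial1 f x y) (partial2 f x y).

Definition Moutard_normal (n1 n2 : R -> vec3) (q12 : R -> R -> R) (r : R)
    (n : R -> R -> vec3) : Prop :=
  smooth_field n /\
  (forall x y, in_square r x y ->
     partial1 (partial2 n) x y = scal (q12 x y) (n x y)) /\
  (forall x, 0 <= x <= r -> n x 0 = n1 x) /\
  (forall y, 0 <= y <= r -> n 0 y = n2 y).

Definition Lelieuvre (r : R) (n f : R -> R -> vec3) : Prop :=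
  forall x y, in_square r x y ->
    partial1 f x y = cross (partial1 n x y) (n x y) /\
    partial2 f x y = cross (n x y) (partial2 n x y).

Definition A_surface_with_data (n1 n2 : R -> vec3) (q12 : R -> R -> R) (r : R)
    (f : R -> R -> vec3) : Prop :=
  A_surface r f /\
  exists n : R -> R -> vec3, Moutard_normal n1 n2 q12 r n /\ Lelieuvre r n f.

(* The grid B^eps(r) = (eps Z)^2 /\ [0,r]^2.  Lattice functions are represented
   by functions of real arguments of which only the values at lattice points
   are ever constrained. *)
Definition in_grid (eps r x y : R) : Prop :=
  (exists i j : Z, x = eps * IZR i /\ y = eps * IZR j) /\ in_square r x y.

Definition tau1 (eps : R) (g : R -> R -> vec3) (x y : R) : vec3 := g (x + eps) y.
Definition tau2 (eps : R) (g : R -> R -> vec3) (x y : R) : vec3 := g x (y + eps).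

Definition delta1 (eps : R) (g : R -> R -> vec3) (x y : R) : vec3 :=
  scal (/ eps) (minus (tau1 eps g x y) (g x y)).
Definition delta2 (eps : R) (g : R -> R -> vec3) (x y : R) : vec3 :=
  scal (/ eps) (minus (tau2 eps g x y) (g x y)).

Definition delta (eps : R) (a1 a2 : nat) (g : R -> R -> vec3) : R -> R -> vec3 :=
  Nat.iter a1 (delta1 eps) (Nat.iter a2 (delta2 eps) g).

(* Both discrete systems are imposed on those elementary squares, respectively
   edges, of the lattice all of whose vertices lie in B^eps(r).  (On the whole
   of (eps Z)^2 a solution need not exist, as the coefficient may vanish.) *)
Definition discrete_Moutard_normal (n1 n2 : R -> vec3) (q12 : R -> R -> R)
    (r eps : R) (ne : R -> R -> vec3) : Prop :=
  (forall x y, in_grid eps r x y -> in_grid eps r (x + eps) (y + eps) ->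
     plus (tau1 eps (tau2 eps ne) x y) (ne x y) =
     scal (1 + / 2 * eps ^ 2 * q12 x y)
          (plus (tau1 eps ne x y) (tau2 eps ne x y))) /\
  (forall x, in_grid eps r x 0 -> ne x 0 = n1 x) /\
  (forall y, in_grid eps r 0 y -> ne 0 y = n2 y).

Definition discrete_Lelieuvre (r eps : R) (ne fe : R -> R -> vec3) : Prop :=
  (forall x y, in_grid eps r x y -> in_grid eps r (x + eps) y ->
     delta1 eps fe x y = cross (delta1 eps ne x y) (ne x y)) /\
  (forall x y, in_grid eps r x y -> in_grid eps r x (y + eps) ->
     delta2 eps fe x y = cross (ne x y) (delta2 eps ne x y)).

Definition canonical_discrete_A_surface (n1 n2 : R -> vec3) (q12 : R -> R -> R)
    (r eps : R) (fe : R -> R -> vec3) : Prop :=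
  exists ne : R -> R -> vec3,
    discrete_Moutard_normal n1 n2 q12 r eps ne /\ discrete_Lelieuvre r eps ne fe.

(* The difference quotient of order (a1, a2) at (x, y) is defined on B^eps(r)
   exactly when (x, y) and (x + a1 eps, y + a2 eps) belong to B^eps(r). *)
Definition converges_smoothly_order_eps (r : R) (fe : R -> R -> R -> vec3)
    (f : R -> R -> vec3) : Prop :=
  forall a1 a2 : nat, exists c eps0 : R, 0 < eps0 /\
    forall eps, 0 < eps < eps0 ->
    forall x y, in_grid eps r x y ->
      in_grid eps r (x + INR a1 * eps) (y + INR a2 * eps) ->
      norm (delta eps a1 a2 (fun s t => minus (fe eps s t) (f s t)) x y)
        <= c * eps.

(* Main.v *)
(** Everything is done coordinatewise.  The Moutard equation with data on the two
    axes is the Volterra equation [u = a + b - a 0 + int_0^x int_0^y q u]; its Picard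
    series converges on all of [R^2], and smoothness of a continuous solution follows by
    bootstrapping, since both partial derivatives of [u] are again single integrals of
    [q u].  The Lelieuvre formulas give a closed 1-form, which is integrated along
    axis-parallel paths.

    For the convergence, call a family of lattice functions [O(eps^k)] when all its
    difference quotients are.  For smooth [g] the error [delta_i g - partial_i g] is
    [O(eps)], so the restriction of the smooth normal field to the lattice satisfies the
    discrete Moutard equation up to an [O(eps)] residual.  The difference [e] of the
    discrete and the smooth normals hence satisfies
    [delta_1 delta_2 e = q/2 (tau_1 e + tau_2 e) + O(eps)] with zero data on the axes.
    A discrete Gronwall argument, in which smallness of [r] is used, bounds [e]; every
    higher difference quotient is obtained from lower ones by applying the equation, or
    by summing it once when the quotient is taken in one direction only.  The surface
    error is then controlled through the Lelieuvre formulas by the product rule and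
    summation from the origin. *)

Require Import Defs.
From Stdlib Require Import ZArith Reals Factorial Lra Lia FunctionalExtensionality ClassicalEpsilon.
From Coquelicot Require Import Coquelicot.
Open Scope R_scope.

(** * Smooth functions on the plane *)

(** The conditions on a competing surface and its normal hold only on the closed square, while
    [Derive] is two-sided. Uniqueness therefore compares derivatives only at inner points of
    segments, and continuity takes care of the endpoints. In the same way a lattice function is
    constrained only inside the square, so each discrete estimate records how many lattice steps it
    needs before the edge.

    Neither the smooth nor the discrete existence proof asks [r] to be small: the smooth normal
    lives on the whole plane and the discrete one on the whole quadrant. The size of [r] is
    restricted for uniqueness and for the Gronwall estimate.

    The convergence claim concerns arbitrary solutions of the discrete systems inside the square, so
    its estimates use only the equations and not the explicit recursion that proves existence. *)

Definition dx (g : R -> R -> R) (x y : R) : R := Derive (fun t => g t y) x.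
Definition dy (g : R -> R -> R) (x y : R) : R := Derive (fun t => g x t) y.

Definition C0 (g : R -> R -> R) : Prop := forall x y, continuity_2d_pt g x y.
Definition diff1 (g : R -> R -> R) : Prop :=
  forall x y, ex_derive (fun t => g t y) x.
Definition diff2 (g : R -> R -> R) : Prop :=
  forall x y, ex_derive (fun t => g x t) y.
Definition Cn (k : nat) (g : R -> R -> R) : Prop := forall x y, ex_diff_n g k x y.

Lemma Cn_S (k : nat) (g : R -> R -> R) :
  Cn (S k) g <-> C0 g /\ diff1 g /\ diff2 g /\ Cn k (dx g) /\ Cn k (dy g).
Proof.
  split.
  - intros H; repeat split; intros x y; apply (H x y).
  - intros (H0 & H1 & H2 & H3 & H4) x y.
    split; [apply H0 | split; [apply H1 | split; [apply H2 | split]]];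
      [apply H3 | apply H4].
Qed.

Lemma Cn_C0 (k : nat) (g : R -> R -> R) : Cn k g -> C0 g.
Proof. intros H x y; specialize (H x y); destruct k; apply H. Qed.

Lemma C0_Cn (g : R -> R -> R) : C0 g -> Cn 0 g.
Proof. intros H x y; split; auto. Qed.

Lemma Cn_pred (k : nat) : forall g, Cn (S k) g -> Cn k g.
Proof.
  induction k as [|k IH]; intros g H.
  - apply C0_Cn, (Cn_C0 _ _ H).
  - apply Cn_S in H; destruct H as (H0 & H1 & H2 & H3 & H4).
    apply Cn_S; auto 6.
Qed.

Lemma smooth_C0 g : smooth_R2 g -> C0 g.
Proof. intros H; apply (Cn_C0 0 _ (H 0%nat)). Qed.

Lemma smooth_diff1 g : smooth_R2 g -> diff1 g.
Proof. intros H; apply (proj1 (Cn_S 0 g) (H 1%nat)). Qed.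

Lemma smooth_diff2 g : smooth_R2 g -> diff2 g.
Proof. intros H; apply (proj1 (Cn_S 0 g) (H 1%nat)). Qed.

Lemma smooth_dx g : smooth_R2 g -> smooth_R2 (dx g).
Proof. intros H k; apply (proj1 (Cn_S k g) (H (S k))). Qed.

Lemma smooth_dy g : smooth_R2 g -> smooth_R2 (dy g).
Proof. intros H k; apply (proj1 (Cn_S k g) (H (S k))). Qed.

Lemma C0_slice1 g x y : C0 g -> continuous (fun t => g t y) x.
Proof.
  intros H.
  apply continuity_pt_filterlim.
  intros eps Heps.
  destruct (H x y (mkposreal eps Heps)) as [d Hd].
  exists d; split; [apply cond_pos|].
  intros z [_ Hz]; apply Hd; [exact Hz|].
  rewrite Rminus_diag, Rabs_R0; apply cond_pos.
Qed.

Lemma C0_slice2 g x y : C0 g -> continuous (fun t => g x t) y.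
Proof.
  intros H.
  apply continuity_pt_filterlim.
  intros eps Heps.
  destruct (H x y (mkposreal eps Heps)) as [d Hd].
  exists d; split; [apply cond_pos|].
  intros z [_ Hz]; apply Hd; [|exact Hz].
  rewrite Rminus_diag, Rabs_R0; apply cond_pos.
Qed.

Lemma smooth_schwarz g : smooth_R2 g -> dy (dx g) = dx (dy g).
Proof.
  intros H; apply functional_extensionality; intros x;
    apply functional_extensionality; intros y.
  symmetry; apply (Schwarz g x y).
  - exists (mkposreal 1 Rlt_0_1); intros u v _ _.
    repeat split.
    + apply (smooth_diff1 _ H).
    + apply (smooth_diff2 _ H).
    + apply (smooth_diff1 _ (smooth_dy _ H)).
    + apply (smooth_diff2 _ (smooth_dx _ H)).
  - apply (smooth_C0 _ (smooth_dx _ (smooth_dy _ H))).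
  - apply (smooth_C0 _ (smooth_dy _ (smooth_dx _ H))).
Qed.

(** The C^k inductions below pass through this form: explicit partial derivatives are identified
    with [dx g] and [dy g] as functions, so the recursive definition can be rewritten. *)
Lemma Cn_of_partials k g g1 g2 : C0 g ->
  (forall x y, is_derive (fun t => g t y) x (g1 x y)) ->
  (forall x y, is_derive (fun t => g x t) y (g2 x y)) ->
  Cn k g1 -> Cn k g2 -> Cn (S k) g.
Proof.
  intros H0 H1 H2 H3 H4; apply Cn_S.
  assert (E1 : dx g = g1).
  { do 2 (apply functional_extensionality; intro); apply is_derive_unique, H1. }
  assert (E2 : dy g = g2).
  { do 2 (apply functional_extensionality; intro); apply is_derive_unique, H2. }
  rewrite E1, E2; repeat split; auto.
  - intros x y; exists (g1 x y); apply H1.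
  - intros x y; exists (g2 x y); apply H2.
Qed.

Lemma is_dx g x y : diff1 g -> is_derive (fun t => g t y) x (dx g x y).
Proof. intros H; apply Derive_correct, H. Qed.

Lemma is_dy g x y : diff2 g -> is_derive (fun t => g x t) y (dy g x y).
Proof. intros H; apply Derive_correct, H. Qed.

Lemma Cn_const k c : Cn k (fun _ _ => c).
Proof.
  revert c; induction k as [|k IH]; intros c.
  - apply C0_Cn; intros x y; apply continuity_2d_pt_const.
  - apply (Cn_of_partials k _ (fun _ _ => 0) (fun _ _ => 0)); auto.
    + intros x y; apply continuity_2d_pt_const.
    + intros x y; apply (is_derive_const c).
    + intros x y; apply (is_derive_const c).
Qed.

Lemma Cn_plus k : forall f g, Cn k f -> Cn k g -> Cn k (fun x y => f x y + g x y).
Proof.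
  induction k as [|k IH]; intros f g Hf Hg.
  - apply C0_Cn; intros x y; apply continuity_2d_pt_plus;
      [apply (Cn_C0 _ _ Hf) | apply (Cn_C0 _ _ Hg)].
  - apply Cn_S in Hf; apply Cn_S in Hg.
    destruct Hf as (F0 & F1 & F2 & F3 & F4), Hg as (G0 & G1 & G2 & G3 & G4).
    apply (Cn_of_partials k _ (fun x y => dx f x y + dx g x y)
             (fun x y => dy f x y + dy g x y)); auto.
    + intros x y; apply continuity_2d_pt_plus; auto.
    + intros x y; apply (is_derive_plus (fun t => f t y) (fun t => g t y));
        apply is_dx; auto.
    + intros x y; apply (is_derive_plus (fun t => f x t) (fun t => g x t));
        apply is_dy; auto.
Qed.

Lemma Cn_mult k : forall f g, Cn k f -> Cn k g -> Cn k (fun x y => f x y * g x y).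
Proof.
  induction k as [|k IH]; intros f g Hf Hg.
  - apply C0_Cn; intros x y; apply continuity_2d_pt_mult;
      [apply (Cn_C0 _ _ Hf) | apply (Cn_C0 _ _ Hg)].
  - pose proof (Cn_pred _ _ Hf) as Hf'; pose proof (Cn_pred _ _ Hg) as Hg'.
    apply Cn_S in Hf; apply Cn_S in Hg.
    destruct Hf as (F0 & F1 & F2 & F3 & F4), Hg as (G0 & G1 & G2 & G3 & G4).
    apply (Cn_of_partials k _ (fun x y => dx f x y * g x y + f x y * dx g x y)
             (fun x y => dy f x y * g x y + f x y * dy g x y)).
    + intros x y; apply continuity_2d_pt_mult; auto.
    + intros x y; apply (is_derive_mult (fun t => f t y) (fun t => g t y));
        [apply is_dx; auto | apply is_dx; auto | apply Rmult_comm].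
    + intros x y; apply (is_derive_mult (fun t => f x t) (fun t => g x t));
        [apply is_dy; auto | apply is_dy; auto | apply Rmult_comm].
    + apply Cn_plus; apply IH; auto.
    + apply Cn_plus; apply IH; auto.
Qed.

Lemma smooth_const c : smooth_R2 (fun _ _ => c).
Proof. intros k; apply Cn_const. Qed.

Lemma smooth_plus f g : smooth_R2 f -> smooth_R2 g ->
  smooth_R2 (fun x y => f x y + g x y).
Proof. intros F G k; apply (Cn_plus k f g (F k) (G k)). Qed.

Lemma smooth_mult f g : smooth_R2 f -> smooth_R2 g ->
  smooth_R2 (fun x y => f x y * g x y).
Proof. intros F G k; apply (Cn_mult k f g (F k) (G k)). Qed.

Lemma smooth_scal c f : smooth_R2 f -> smooth_R2 (fun x y => c * f x y).
Proof. intros F; apply (smooth_mult (fun _ _ => c)); [apply smooth_const | auto]. Qed.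

Lemma smooth_minus f g : smooth_R2 f -> smooth_R2 g ->
  smooth_R2 (fun x y => f x y - g x y).
Proof.
  intros F G.
  replace (fun x y => f x y - g x y) with (fun x y => f x y + (-1) * g x y)
    by (do 2 (apply functional_extensionality; intro); ring).
  apply smooth_plus; [|apply smooth_scal]; auto.
Qed.

(** All derivatives of [h] are treated at once, because differentiating lowers [k] but replaces [j]
    by [S j]. *)
Lemma Cn_comp1 k h : forall j, smooth_R h -> Cn k (fun x _ => Derive_n h j x).
Proof.
  induction k as [|k IH]; intros j H.
  - apply C0_Cn; intros x y.
    apply (continuity_1d_2d_pt_comp (Derive_n h j) (fun x _ => x)).
    + apply continuity_pt_filterlim, (ex_derive_continuous (Derive_n h j)), (H (S j)).
    + apply continuity_2d_pt_id1.
  - apply (Cn_of_partials k _ (fun x _ => Derive_n h (S j) x) (fun _ _ => 0)); auto.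
    + apply (Cn_C0 0), C0_Cn; intros x y.
      apply (continuity_1d_2d_pt_comp (Derive_n h j) (fun x _ => x)).
      * apply continuity_pt_filterlim, (ex_derive_continuous (Derive_n h j)), (H (S j)).
      * apply continuity_2d_pt_id1.
    + intros x y; apply (Derive_correct (Derive_n h j)), (H (S j)).
    + intros x y; apply (is_derive_const (Derive_n h j x)).
    + apply Cn_const.
Qed.

Lemma Cn_comp2 k h : forall j, smooth_R h -> Cn k (fun _ y => Derive_n h j y).
Proof.
  assert (P : forall j, smooth_R h -> C0 (fun _ y => Derive_n h j y)).
  { intros j H x y.
    apply (continuity_1d_2d_pt_comp (Derive_n h j) (fun _ y => y)).
    - apply continuity_pt_filterlim, (ex_derive_continuous (Derive_n h j)), (H (S j)).
    - apply continuity_2d_pt_id2. }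
  induction k as [|k IH]; intros j H.
  - apply C0_Cn, P, H.
  - apply (Cn_of_partials k _ (fun _ _ => 0) (fun _ y => Derive_n h (S j) y)); auto.
    + intros x y; apply (is_derive_const (Derive_n h j y)).
    + intros x y; apply (Derive_correct (Derive_n h j)), (H (S j)).
    + apply Cn_const.
Qed.

Lemma smooth_comp1 h : smooth_R h -> smooth_R2 (fun x _ => h x).
Proof. intros H k; apply (Cn_comp1 k h 0 H). Qed.

Lemma smooth_comp2 h : smooth_R h -> smooth_R2 (fun _ y => h y).
Proof. intros H k; apply (Cn_comp2 k h 0 H). Qed.

(** Compactness in gauge form: around each point the gauge [d] is so small that [g] varies by less
    than 1, and also at most [1 / (1 + |g|)]. A uniform lower bound [e] on the gauge then turns into
    the upper bound [1 / e] on [|g|]. *)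
Lemma C0_bounded g a b : C0 g ->
  exists M, 0 <= M /\ forall x y, a <= x <= b -> a <= y <= b -> Rabs (g x y) <= M.
Proof.
  intros H.
  assert (D : forall x y, exists d : posreal,
    d <= / (1 + Rabs (g x y)) /\ forall u v, Rabs (u - x) < d -> Rabs (v - y) < d ->
      Rabs (g u v - g x y) < 1).
  { intros x y.
    assert (P : 0 < / (1 + Rabs (g x y))).
    { apply Rinv_0_lt_compat; pose proof (Rabs_pos (g x y)); lra. }
    destruct (H x y (mkposreal 1 Rlt_0_1)) as [d Hd].
    exists (mkposreal (Rmin d (/ (1 + Rabs (g x y))))
              (Rmin_pos _ _ (cond_pos d) P)); split; simpl.
    - apply Rmin_r.
    - intros u v Hu Hv; apply Hd; (eapply Rlt_le_trans; [eassumption | apply Rmin_l]). }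
  destruct (choice (fun p (d : posreal) => d <= / (1 + Rabs (g (fst p) (snd p))) /\
    forall u v, Rabs (u - fst p) < d -> Rabs (v - snd p) < d ->
      Rabs (g u v - g (fst p) (snd p)) < 1) (fun p => D (fst p) (snd p)))
    as [d Hd].
  destruct (compactness_value_2d a b a b (fun x y => d (x, y))) as [e He].
  exists (/ e); split.
  { left; apply Rinv_0_lt_compat, cond_pos. }
  intros x y Hx Hy.
  destruct (NNPP _ (He x y Hx Hy)) as (u & v & Hu & Hv & Hxu & Hyv & Hde).
  destruct (Hd (u, v)) as [L1 L2]; simpl in L1, L2.
  pose proof (L2 x y Hxu Hyv) as L3.
  assert (L4 : 1 + Rabs (g u v) <= / e).
  { pose proof (Rabs_pos (g u v)).
    rewrite <- (Rinv_inv (1 + Rabs (g u v))).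
    apply Rinv_le_contravar; [apply cond_pos | lra]. }
  apply Rle_trans with (2 := L4).
  replace (g x y) with ((g x y - g u v) + g u v) by ring.
  eapply Rle_trans; [apply Rabs_triang | lra].
Qed.

(** * Bounds for integrals with a variable endpoint *)

Lemma ex_RInt_C (h : R -> R) a b : (forall s, continuous h s) -> ex_RInt h a b.
Proof. intros H; apply (ex_RInt_continuous h); auto. Qed.

(** Integrating [c |s|^k] produces the factor [1 / (k+1)] from which the factorial in the Picard
    estimate arises. A negative endpoint is reduced to a positive one by the reflection of [s] to
    [- s]. *)
Lemma RInt_pow_bound (h : R -> R) c k x :
  (forall s, continuous h s) ->
  (forall s, Rabs s <= Rabs x -> Rabs (h s) <= c * Rabs s ^ k) ->
  Rabs (RInt h 0 x) <= c * (Rabs x ^ S k / INR (S k)).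
Proof.
  assert (P : forall (h : R -> R) x, 0 <= x -> (forall s, continuous h s) ->
    (forall s, Rabs s <= Rabs x -> Rabs (h s) <= c * Rabs s ^ k) ->
    Rabs (RInt h 0 x) <= c * (Rabs x ^ S k / INR (S k))).
  { clear h x; intros h x Hx Hc Hb.
    assert (I : is_RInt (fun s => c * s ^ k) 0 x (c * (x ^ S k / INR (S k)))).
    { replace (c * (x ^ S k / INR (S k))) with
        (minus (c * (x ^ S k / INR (S k))) (c * (0 ^ S k / INR (S k)))).
      2:{ change (c * (x ^ S k / INR (S k)) - (c * (0 ^ S k / INR (S k))) =
                  c * (x ^ S k / INR (S k))).
          rewrite (pow_i (S k)) by lia; unfold Rdiv; ring. }
      apply (is_RInt_derive (fun s => c * (s ^ S k / INR (S k)))).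
      - intros s _; auto_derive; [trivial|].
        change (match k with 0%nat => 1 | S _ => INR k + 1 end) with (INR (S k)).
        field; apply not_0_INR; lia.
      - intros s _. apply (ex_derive_continuous (fun s => c * s ^ k)).
        auto_derive; trivial. }
    rewrite (Rabs_pos_eq x Hx), <- (is_RInt_unique _ _ _ _ I).
    eapply Rle_trans; [apply abs_RInt_le; [exact Hx | apply ex_RInt_C, Hc]|].
    apply RInt_le; auto.
    - apply ex_RInt_C; intros s; apply (continuous_comp h Rabs); auto.
      apply continuous_Rabs.
    - eexists; apply I.
    - intros s Hs; rewrite <- (Rabs_pos_eq s) at 2 by lra; apply Hb.
      rewrite !Rabs_pos_eq by lra; lra. }
  intros Hc Hb; destruct (Rle_dec 0 x) as [Hx|Hx]; [apply P; auto|].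
  assert (E : RInt h 0 x = - RInt (fun s => h (- s)) 0 (- x)).
  { pose proof (RInt_comp_lin h (-1) 0 0 (- x)) as L.
    replace (-1 * 0 + 0) with 0 in L by ring.
    replace (-1 * - x + 0) with x in L by ring.
    rewrite <- L by (apply ex_RInt_C, Hc).
    rewrite <- (RInt_opp (fun s => h (- s))).
    2:{ apply ex_RInt_C; intros s; apply (continuous_comp Ropp h); [|apply Hc].
        apply (continuous_opp (fun s : R => s)), continuous_id. }
    apply RInt_ext; intros s _.
    replace (-1 * s + 0) with (- s) by ring.
    change (-1 * h (- s) = - h (- s)); ring. }
  rewrite E, Rabs_Ropp, <- (Rabs_Ropp x); apply P.
  - lra.
  - intros s; apply (continuous_comp Ropp h); [|apply Hc].
    apply (continuous_opp (fun s : R => s)), continuous_id.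
  - intros s Hs; rewrite <- (Rabs_Ropp s); apply Hb; rewrite Rabs_Ropp.
    rewrite Rabs_Ropp in Hs; exact Hs.
Qed.

Lemma RInt_bound (h : R -> R) c x :
  (forall s, continuous h s) -> (forall s, Rabs s <= Rabs x -> Rabs (h s) <= c) ->
  Rabs (RInt h 0 x) <= c * Rabs x.
Proof.
  intros Hc Hb.
  replace (c * Rabs x) with (c * (Rabs x ^ 1 / INR 1)) by (simpl; field).
  apply RInt_pow_bound; auto.
  intros s Hs; rewrite pow_O, Rmult_1_r; auto.
Qed.

(** * The Goursat problem for the Moutard equation *)

Definition I1 (g : R -> R -> R) (x y : R) : R := RInt (fun t => g t y) 0 x.
Definition I2 (g : R -> R -> R) (x y : R) : R := RInt (fun t => g x t) 0 y.

Lemma C0_swap g : C0 g -> C0 (fun x y => g y x).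
Proof.
  intros H x y eps; destruct (H y x eps) as [d Hd].
  exists d; intros u v Hu Hv; apply Hd; auto.
Qed.

Lemma is_derive_RInt_0 (h : R -> R) y : (forall s, continuous h s) ->
  is_derive (fun z => RInt h 0 z) y (h y).
Proof.
  intros H; apply (is_derive_RInt h (fun z => RInt h 0 z) 0 y); [|apply H].
  exists (mkposreal 1 Rlt_0_1); intros z _.
  apply (RInt_correct h), ex_RInt_C, H.
Qed.

Lemma I2_dy g x y : C0 g -> is_derive (fun t => I2 g x t) y (g x y).
Proof.
  intros H; apply (is_derive_RInt_0 (fun t => g x t)).
  intros s; apply C0_slice2, H.
Qed.

Lemma I1_dx g x y : C0 g -> is_derive (fun t => I1 g t y) x (g x y).
Proof. intros H; apply (I2_dy (fun y x => g x y) y x), C0_swap, H. Qed.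

Lemma I2_dx g x y : C0 g -> diff1 g -> C0 (dx g) ->
  is_derive (fun t => I2 g t y) x (I2 (dx g) x y).
Proof.
  intros H H1 H2; apply (is_derive_RInt_param g 0 y x).
  - exists (mkposreal 1 Rlt_0_1); intros z _ t _; apply H1.
  - intros t _; apply H2.
  - exists (mkposreal 1 Rlt_0_1); intros z _; apply ex_RInt_C; intros s.
    apply C0_slice2, H.
Qed.

Lemma I1_dy g x y : C0 g -> diff2 g -> C0 (dy g) ->
  is_derive (fun t => I1 g x t) y (I1 (dy g) x y).
Proof.
  intros H H1 H2; apply (I2_dx (fun y x => g x y) y x).
  - apply C0_swap, H.
  - intros u v; apply H1.
  - apply (C0_swap (dy g)), H2.
Qed.

(** The derivative is controlled on the open interval and continuity covers the endpoints; this
    suits equations that are usable only at inner points of a segment. The endpoints may come in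
    either order. *)
Lemma mvt_bound (h h' : R -> R) a b M :
  (forall s, Rmin a b < s < Rmax a b -> is_derive h s (h' s)) ->
  (forall s, Rmin a b <= s <= Rmax a b -> continuous h s) ->
  (forall s, Rmin a b < s < Rmax a b -> Rabs (h' s) <= M) -> 0 <= M ->
  Rabs (h b - h a) <= M * Rabs (b - a).
Proof.
  intros H C B HM.
  assert (C' : forall s, Rmin a b <= s <= Rmax a b -> continuity_pt h s).
  { intros s Hs; apply continuity_pt_filterlim, C, Hs. }
  assert (P : forall a b, a < b ->
    (forall s, a < s < b -> is_derive h s (h' s)) ->
    (forall s, a <= s <= b -> continuity_pt h s) ->
    (forall s, a < s < b -> Rabs (h' s) <= M) ->
    Rabs (h b - h a) <= M * Rabs (b - a)).
  { clear; intros a b Hab H C B.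
    destruct (MVT h id a b (fun c Hc => exist (derivable_pt_abs h c) (h' c)
       (proj1 (is_derive_Reals h c (h' c)) (H c Hc)))
       (fun c _ => derivable_pt_id c) Hab C
       (fun c _ => derivable_continuous_pt _ _ (derivable_pt_id c)))
      as (c & Hc & E).
    assert (E' : (b - a) * h' c = (h b - h a) * 1).
    { rewrite <- (derive_pt_id c); exact E. }
    replace (h b - h a) with (h' c * (b - a)) by lra.
    rewrite Rabs_mult; apply Rmult_le_compat_r; [apply Rabs_pos | auto]. }
  destruct (Rtotal_order a b) as [L|[L|L]].
  - rewrite Rmin_left, Rmax_right in * by lra; apply P; auto.
  - subst; rewrite !Rminus_diag, Rabs_R0; lra.
  - rewrite Rmin_right, Rmax_left in * by lra.
    rewrite (Rabs_minus_sym (h b)), (Rabs_minus_sym b); apply P; auto.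
Qed.

Lemma abs_between a b A s : Rabs a <= A -> Rabs b <= A ->
  Rmin a b <= s <= Rmax a b -> - A <= s <= A.
Proof.
  intros Ha Hb Hs; apply Rabs_le_between in Ha; apply Rabs_le_between in Hb.
  revert Hs; unfold Rmin, Rmax; destruct (Rle_dec a b); lra.
Qed.

(** The increment splits into a change of the upper limit, controlled by a bound on [g], and a
    change of the parameter, controlled by uniform continuity of [g] on a box. *)
Lemma C0_I2 g : C0 g -> C0 (I2 g).
Proof.
  intros H x y eps.
  (* The box of half-width [A] contains all points within distance 1 of [(x, y)] in each coordinate,
     together with the segments of integration that start on the axis. *)
  set (A := Rabs x + Rabs y + 1).
  assert (HA : 1 <= A) by (unfold A; pose proof (Rabs_pos x); pose proof (Rabs_pos y); lra).
  destruct (C0_bounded g (- A) A H) as (M & HM & HB).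
  pose proof (cond_pos eps) as He.
  assert (P1 : 0 < eps / (2 * A)) by (apply Rdiv_lt_0_compat; lra).
  assert (P2 : 0 < eps / (2 * (M + 1))) by (apply Rdiv_lt_0_compat; lra).
  destruct (uniform_continuity_2d g (- A) A (- A) A (fun u v _ _ => H u v)
              (mkposreal _ P1)) as [d Hd]; simpl in Hd.
  assert (P3 : 0 < Rmin 1 (Rmin d (eps / (2 * (M + 1))))).
  { repeat apply Rmin_pos; [lra | apply cond_pos | exact P2]. }
  exists (mkposreal _ P3); simpl; intros u v Hu Hv.
  assert (Q : forall z, z < Rmin 1 (Rmin d (eps / (2 * (M + 1)))) ->
            z < 1 /\ z < d /\ z < eps / (2 * (M + 1))).
  { intros z Hz; repeat split; eapply Rlt_le_trans; try exact Hz.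
    - apply Rmin_l.
    - eapply Rle_trans; [apply Rmin_r | apply Rmin_l].
    - eapply Rle_trans; [apply Rmin_r | apply Rmin_r]. }
  destruct (Q _ Hu) as (U1 & U2 & U3), (Q _ Hv) as (V1 & V2 & V3).
  assert (Au : Rabs u <= A).
  { replace u with (x + (u - x)) by ring; eapply Rle_trans; [apply Rabs_triang|].
    unfold A; pose proof (Rabs_pos y); lra. }
  assert (Av : Rabs v <= A).
  { replace v with (y + (v - y)) by ring; eapply Rle_trans; [apply Rabs_triang|].
    unfold A; pose proof (Rabs_pos x); lra. }
  assert (Ax : Rabs x <= A) by (unfold A; pose proof (Rabs_pos y); lra).
  assert (Ay : Rabs y <= A) by (unfold A; pose proof (Rabs_pos x); lra).
  assert (B1 : Rabs (I2 g u v - I2 g u y) <= M * Rabs (v - y)).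
  { apply (mvt_bound (fun t => I2 g u t) (fun t => g u t)); auto.
    - intros s _; apply I2_dy, H.
    - intros s _; apply (ex_derive_continuous (fun t => I2 g u t)).
      exists (g u s); apply I2_dy, H.
    - intros s Hs; apply HB; [apply Rabs_le_between; auto|].
      apply (abs_between y v); auto; lra. }
  assert (B2 : Rabs (I2 g u y - I2 g x y) <= eps / (2 * A) * Rabs y).
  { unfold I2. rewrite <- (RInt_minus (fun t => g u t) (fun t => g x t)).
    2,3 : apply ex_RInt_C; intros s; apply C0_slice2, H.
    apply (RInt_bound (fun t => minus (g u t) (g x t))).
    - intros s; apply (continuous_minus (fun t => g u t) (fun t => g x t));
        apply C0_slice2, H.
    - intros s Hs; left; apply Hd; try (apply Rabs_le_between; lra).
      + exact U2.
      + rewrite Rminus_diag, Rabs_R0; apply cond_pos. }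
  replace (I2 g u v - I2 g x y) with
    ((I2 g u v - I2 g u y) + (I2 g u y - I2 g x y)) by ring.
  eapply Rle_lt_trans; [apply Rabs_triang|].
  assert (L1 : M * Rabs (v - y) < eps / 2).
  { apply Rle_lt_trans with ((M + 1) * Rabs (v - y)).
    - pose proof (Rabs_pos (v - y)); nra.
    - replace (eps / 2) with ((M + 1) * (eps / (2 * (M + 1)))) by (field; lra).
      apply Rmult_lt_compat_l; lra. }
  assert (L2 : eps / (2 * A) * Rabs y <= eps / 2).
  { replace (eps / 2) with (eps / (2 * A) * A) by (field; lra).
    apply Rmult_le_compat_l; lra. }
  lra.
Qed.

Lemma C0_I1 g : C0 g -> C0 (I1 g).
Proof.
  intros H; apply (C0_swap (I2 (fun y x => g x y))), C0_I2, C0_swap, H.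
Qed.

(** One partial derivative of [I2 g] is [g], the other is [I2 (dx g)]; so the integral stays in the
    class of [g]. *)
Lemma Cn_I2 k : forall g, Cn k g -> Cn k (I2 g).
Proof.
  induction k as [|k IH]; intros g H.
  - apply C0_Cn, C0_I2, (Cn_C0 _ _ H).
  - pose proof (Cn_pred _ _ H) as H'; apply Cn_S in H.
    destruct H as (H0 & H1 & H2 & H3 & H4).
    apply (Cn_of_partials k _ (I2 (dx g)) g); auto.
    + apply C0_I2, H0.
    + intros x y; apply I2_dx; auto; apply (Cn_C0 _ _ H3).
    + intros x y; apply I2_dy, H0.
Qed.

Lemma Cn_I1 k : forall g, Cn k g -> Cn k (I1 g).
Proof.
  induction k as [|k IH]; intros g H.
  - apply C0_Cn, C0_I1, (Cn_C0 _ _ H).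
  - pose proof (Cn_pred _ _ H) as H'; apply Cn_S in H.
    destruct H as (H0 & H1 & H2 & H3 & H4).
    apply (Cn_of_partials k _ g (I1 (dy g))); auto.
    + apply C0_I1, H0.
    + intros x y; apply I1_dx, H0.
    + intros x y; apply I1_dy; auto; apply (Cn_C0 _ _ H4).
Qed.

Lemma C0_mult f g : C0 f -> C0 g -> C0 (fun x y => f x y * g x y).
Proof. intros F G x y; apply continuity_2d_pt_mult; auto. Qed.

Section Goursat.

Variables (phi q : R -> R -> R).
Hypothesis phi_cont : C0 phi.
Hypothesis q_cont : C0 q.

Definition goursat_op (g : R -> R -> R) : R -> R -> R :=
  I1 (I2 (fun x y => q x y * g x y)).

Lemma C0_goursat_op g : C0 g -> C0 (goursat_op g).
Proof. intros H; apply C0_I1, C0_I2, C0_mult; auto. Qed.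

Lemma goursat_op_minus f g x y : C0 f -> C0 g ->
  goursat_op f x y - goursat_op g x y = goursat_op (fun x y => f x y - g x y) x y.
Proof.
  intros F G; unfold goursat_op, I1.
  rewrite <- (RInt_minus (V := R_CompleteNormedModule)).
  2,3 : apply ex_RInt_C; intros s;
    apply (C0_slice1 (I2 (fun x y => q x y * _ x y))), C0_I2, C0_mult; auto.
  apply RInt_ext; intros s _; unfold I2.
  change (RInt (fun t => q s t * f s t) 0 y - RInt (fun t => q s t * g s t) 0 y =
    RInt (fun t => q s t * (f s t - g s t)) 0 y).
  rewrite <- (RInt_minus (V := R_CompleteNormedModule)).
  2,3 : apply ex_RInt_C; intros t;
    apply (C0_slice2 (fun x y => q x y * _ x y)), C0_mult; auto.
  apply RInt_ext; intros t _.
  change (q s t * f s t - q s t * g s t = q s t * (f s t - g s t)); ring.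
Qed.

Lemma goursat_op_plus f g : C0 f -> C0 g ->
  goursat_op (fun x y => f x y + g x y) = fun x y => goursat_op f x y + goursat_op g x y.
Proof.
  intros F G; apply functional_extensionality; intros x;
    apply functional_extensionality; intros y.
  apply (Rplus_eq_reg_r (- goursat_op g x y)).
  change (goursat_op (fun x y => f x y + g x y) x y - goursat_op g x y =
    goursat_op f x y + goursat_op g x y + - goursat_op g x y).
  rewrite goursat_op_minus; auto.
  2:{ intros u v; apply continuity_2d_pt_plus; auto. }
  rewrite Rplus_assoc, Rplus_opp_r, Rplus_0_r.
  f_equal; do 2 (apply functional_extensionality; intro); ring.
Qed.

(** The integration in [x] raises the power and gives the denominator; the one in [y] is merely
    estimated by the factor [A]. *)
Lemma goursat_op_bound g A K c k x y : C0 g ->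
  (forall x y, Rabs x <= A -> Rabs y <= A -> Rabs (q x y) <= K) -> 0 <= K ->
  (forall x y, Rabs x <= A -> Rabs y <= A -> Rabs (g x y) <= c * Rabs x ^ k) ->
  Rabs x <= A -> Rabs y <= A -> 0 <= c ->
  Rabs (goursat_op g x y) <= K * A * c * (Rabs x ^ S k / INR (S k)).
Proof.
  intros G Q HK B Hx Hy Hc.
  apply RInt_pow_bound.
  - intros s; apply (C0_slice1 (I2 (fun x y => q x y * g x y))), C0_I2, C0_mult; auto.
  - intros s Hs.
    apply Rle_trans with (K * (c * Rabs s ^ k) * Rabs y).
    + apply RInt_bound.
      * intros t; apply (C0_slice2 (fun x y => q x y * g x y)), C0_mult; auto.
      * intros t Ht; rewrite Rabs_mult; apply Rmult_le_compat; try apply Rabs_pos.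
        -- apply Q; lra.
        -- apply B; lra.
    + replace (K * A * c * Rabs s ^ k) with (K * (c * Rabs s ^ k) * A) by ring.
      apply Rmult_le_compat_l; [|exact Hy].
      pose proof (pow_le _ k (Rabs_pos s)) as P.
      apply Rmult_le_pos; [exact HK | apply Rmult_le_pos; auto].
Qed.

Fixpoint picard (k : nat) : R -> R -> R :=
  match k with 0%nat => phi | S k => goursat_op (picard k) end.

Definition goursat_sol (x y : R) : R := Series (fun k => picard k x y).

Lemma C0_picard k : C0 (picard k).
Proof. induction k; simpl; auto using C0_goursat_op. Qed.

Lemma picard_bound A K M : 0 <= A -> 0 <= K -> 0 <= M ->
  (forall x y, Rabs x <= A -> Rabs y <= A -> Rabs (q x y) <= K) ->
  (forall x y, Rabs x <= A -> Rabs y <= A -> Rabs (phi x y) <= M) ->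
  forall k x y, Rabs x <= A -> Rabs y <= A ->
  Rabs (picard k x y) <= M * (K * A) ^ k / INR (fact k) * Rabs x ^ k.
Proof.
  intros HA HK HM Q F; induction k as [|k IH]; intros x y Hx Hy.
  - simpl; rewrite !Rmult_1_r; unfold Rdiv; rewrite Rinv_1, Rmult_1_r; auto.
  - pose proof (INR_fact_lt_0 k) as Hf.
    assert (P : 0 <= (K * A) ^ k) by (apply pow_le, Rmult_le_pos; auto).
    eapply Rle_trans; [apply (goursat_op_bound (picard k) A K _ k x y (C0_picard k) Q HK IH); auto|].
    + apply Rmult_le_pos; [apply Rmult_le_pos; auto|left; apply Rinv_0_lt_compat, Hf].
    + right; rewrite fact_simpl, mult_INR.
      assert (INR (S k) <> 0) by (apply not_0_INR; lia).
      rewrite <- !tech_pow_Rmult; field; lra.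
Qed.

Lemma is_series_exp x : is_series (fun k => x ^ k / INR (fact k)) (exp x).
Proof.
  pose proof (is_exp_Reals x) as H.
  eapply is_series_ext; [|exact H].
  intros k; simpl; rewrite pow_n_pow; change (x ^ k * / INR (fact k) = x ^ k / INR (fact k)).
  reflexivity.
Qed.

(** Weierstrass test on the square of half-width [A] with the majorant [M (K A^2)^k / k!]. The index
    [N] is the same for all points of the square, which is what continuity of the sum requires. *)
Lemma goursat_unif A : 0 <= A -> forall e, 0 < e ->
  exists N, forall n, (N <= n)%nat -> forall x y, Rabs x <= A -> Rabs y <= A ->
    Rabs (goursat_sol x y - sum_f_R0 (fun k => picard k x y) n) <= e.
Proof.
  intros HA e He.
  destruct (C0_bounded q (- A) A q_cont) as (K & HK & Q).
  destruct (C0_bounded phi (- A) A phi_cont) as (M & HM & F).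
  set (b := fun k => M * ((K * A * A) ^ k / INR (fact k))).
  assert (Hb : ex_series b).
  { apply (ex_series_scal M (fun k => (K * A * A) ^ k / INR (fact k))).
    eexists; apply is_series_exp. }
  assert (B : forall x y, Rabs x <= A -> Rabs y <= A ->
            forall k, Rabs (picard k x y) <= b k).
  { intros x y Hx Hy k.
    eapply Rle_trans; [apply (picard_bound A K M); auto|].
    - intros u v Hu Hv; apply Q; apply Rabs_le_between; auto.
    - intros u v Hu Hv; apply F; apply Rabs_le_between; auto.
    - unfold b; rewrite (Rpow_mult_distr (K * A) A k).
      replace (M * (K * A) ^ k / INR (fact k) * Rabs x ^ k) with
        (M * ((K * A) ^ k * Rabs x ^ k / INR (fact k))) by (unfold Rdiv; ring).
      apply Rmult_le_compat_l; auto.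
      apply Rmult_le_compat_r; [left; apply Rinv_0_lt_compat, INR_fact_lt_0|].
      apply Rmult_le_compat_l; [apply pow_le, Rmult_le_pos; auto|].
      apply pow_incr; split; [apply Rabs_pos | auto]. }
  assert (T : is_lim_seq (sum_f_R0 b) (Series b)).
  { pose proof (Series_correct _ Hb) as L.
    eapply is_lim_seq_ext; [|exact L]. intros n; apply sum_n_Reals. }
  apply is_lim_seq_spec in T.
  destruct (T (mkposreal e He)) as [N HN]; simpl in HN.
  exists N; intros n Hn x y Hx Hy.
  assert (E1 : ex_series (fun k => Rabs (picard k x y))).
  { apply (@ex_series_le R_AbsRing R_CompleteNormedModule _ b); auto.
    intros k. change (Rabs (Rabs (picard k x y)) <= b k). rewrite Rabs_Rabsolu; auto. }
  assert (E2 : ex_series (fun k => picard k x y)) by (apply ex_series_Rabs; auto).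
  unfold goursat_sol; rewrite (Series_incr_n _ (S n)) by (auto; lia); simpl pred.
  replace (sum_f_R0 (fun k => picard k x y) n +
           Series (fun k => picard (S n + k) x y) -
           sum_f_R0 (fun k => picard k x y) n)
    with (Series (fun k => picard (S n + k) x y)) by ring.
  specialize (HN n Hn).
  rewrite (Series_incr_n b (S n)) in HN by (auto; lia); simpl pred in HN.
  apply Rabs_lt_between in HN.
  eapply Rle_trans; [apply Series_Rabs|].
  { apply (ex_series_incr_n (fun k => Rabs (picard k x y)) (S n)), E1. }
  eapply Rle_trans; [apply Series_le|].
  - intros k; split; [apply Rabs_pos|]. apply B; auto.
  - apply (ex_series_incr_n b (S n)), Hb.
  - lra.
Qed.

Lemma C0_sum n : C0 (fun x y => sum_f_R0 (fun k => picard k x y) n).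
Proof.
  induction n as [|n IH]; simpl.
  - apply phi_cont.
  - intros x y; apply continuity_2d_pt_plus; [apply IH | apply (C0_picard (S n))].
Qed.

Lemma C0_goursat_sol : C0 goursat_sol.
Proof.
  intros x y eps; set (A := Rabs x + Rabs y + 1).
  pose proof (Rabs_pos x); pose proof (Rabs_pos y); pose proof (cond_pos eps).
  destruct (goursat_unif A ltac:(unfold A; lra) (eps / 4) ltac:(lra)) as [N HN].
  destruct (C0_sum N x y (mkposreal (eps / 4) ltac:(lra))) as [d Hd]; simpl in Hd.
  assert (P : 0 < Rmin 1 d) by (apply Rmin_pos; [lra | apply cond_pos]).
  exists (mkposreal _ P); simpl; intros u v Hu Hv.
  assert (U : Rabs u <= A /\ Rabs v <= A).
  { split; [replace u with (x + (u - x)) by ring | replace v with (y + (v - y)) by ring];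
      (eapply Rle_trans; [apply Rabs_triang|]);
      unfold A; pose proof (Rmin_l 1 d); lra. }
  pose proof (HN N (le_n N) u v (proj1 U) (proj2 U)) as L1.
  pose proof (HN N (le_n N) x y ltac:(unfold A; lra) ltac:(unfold A; lra)) as L2.
  pose proof (Hd u v ltac:(pose proof (Rmin_r 1 d); lra)
                ltac:(pose proof (Rmin_r 1 d); lra)) as L3.
  apply Rabs_le_between in L1; apply Rabs_le_between in L2; apply Rabs_lt_between in L3.
  apply Rabs_lt_between; lra.
Qed.

Lemma sum_goursat n :
  (fun x y => sum_f_R0 (fun k => picard k x y) (S n)) =
  (fun x y => phi x y + goursat_op (fun x y => sum_f_R0 (fun k => picard k x y) n) x y).
Proof.
  induction n as [|n IH].
  - reflexivity.
  - change (fun x y => sum_f_R0 (fun k => picard k x y) (S n)) with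
      (fun x y => sum_f_R0 (fun k => picard k x y) n + picard (S n) x y).
    rewrite (goursat_op_plus (fun x y => sum_f_R0 (fun k => picard k x y) n))
      by auto using C0_sum, C0_picard.
    apply functional_extensionality; intros x; apply functional_extensionality; intros y.
    apply (f_equal (fun g => g x y)) in IH.
    change (sum_f_R0 (fun k => picard k x y) (S n) + goursat_op (picard (S n)) x y =
      phi x y + (goursat_op (fun x y => sum_f_R0 (fun k => picard k x y) n) x y
                 + goursat_op (picard (S n)) x y)).
    cbv beta in IH; rewrite IH; ring.
Qed.

(** The partial sums satisfy the equation with a shift of the index, and the operator is bounded on
    the square, so the equation survives the uniform limit. *)
Lemma goursat_sol_fix x y : goursat_sol x y = phi x y + goursat_op goursat_sol x y.
Proof.
  set (A := Rabs x + Rabs y).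
  pose proof (Rabs_pos x); pose proof (Rabs_pos y).
  destruct (C0_bounded q (- A) A q_cont) as (K & HK & Q).
  apply Rminus_diag_uniq, Rabs_eq_0, Rle_antisym; [|apply Rabs_pos].
  apply le_epsilon; intros e He; rewrite Rplus_0_l.
  assert (HA : 0 <= A) by (unfold A; lra).
  assert (P : 0 < 1 + K * A * A).
  { pose proof (Rmult_le_pos _ _ (Rmult_le_pos _ _ HK HA) HA); lra. }
  (* Two errors arise: [e'] from truncating the series, and at most [K A^2 e'] from the operator
     applied to the truncation error. Together they make [e]. *)
  set (e' := e / (1 + K * A * A)).
  assert (He' : 0 < e') by (apply Rdiv_lt_0_compat; auto).
  destruct (goursat_unif A HA e' He') as [N HN].
  pose proof (HN (S N) ltac:(lia) x y ltac:(unfold A; lra) ltac:(unfold A; lra)) as L1.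
  rewrite (f_equal (fun g => g x y) (sum_goursat N) :
    sum_f_R0 (fun k => picard k x y) (S N) = _) in L1.
  pose proof (goursat_op_minus goursat_sol
    (fun x y => sum_f_R0 (fun k => picard k x y) N) x y C0_goursat_sol (C0_sum N)) as E.
  assert (L2 : Rabs (goursat_op (fun x y => goursat_sol x y -
     sum_f_R0 (fun k => picard k x y) N) x y) <= K * A * e' * (Rabs x ^ 1 / INR 1)).
  { apply (goursat_op_bound _ A K e' 0); try (unfold A; lra).
    - intros u v; apply continuity_2d_pt_minus; [apply C0_goursat_sol | apply C0_sum].
    - intros u v Hu Hv; apply Q; apply Rabs_le_between; auto.
    - intros u v Hu Hv; rewrite pow_O, Rmult_1_r; apply HN; auto. }
  rewrite <- E in L2; clear E.
  replace (Rabs x ^ 1 / INR 1) with (Rabs x) in L2 by (simpl; field).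
  assert (L3 : K * A * e' * Rabs x <= K * A * e' * A).
  { apply Rmult_le_compat_l; [|unfold A; lra].
    apply Rmult_le_pos; [apply Rmult_le_pos; auto | lra]. }
  assert (L4 : e = e' + K * A * e' * A) by (unfold e'; field; lra).
  apply Rabs_le_between in L1; apply Rabs_le_between in L2.
  apply Rabs_le_between; lra.
Qed.

End Goursat.

Lemma RInt_0 (h : R -> R) : RInt h 0 0 = 0.
Proof. apply (RInt_point 0 h). Qed.

Lemma goursat_exists (a b : R -> R) (q : R -> R -> R) :
  smooth_R a -> smooth_R b -> a 0 = b 0 -> smooth_R2 q ->
  exists u, smooth_R2 u /\
    (forall x y, dx (dy u) x y = q x y * u x y) /\
    (forall x, u x 0 = a x) /\ (forall y, u 0 y = b y).
Proof.
  intros Ha Hb Hab Hq.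
  (* Since [a 0 = b 0], this function takes the prescribed values on both axes; its mixed derivative
     vanishes. *)
  set (phi := fun x y => a x + b y - a 0).
  assert (Sphi : smooth_R2 phi).
  { apply smooth_minus; [|apply smooth_const].
    apply smooth_plus; [apply smooth_comp1, Ha | apply smooth_comp2, Hb]. }
  pose proof (smooth_C0 _ Sphi) as Cphi; pose proof (smooth_C0 _ Hq) as Cq.
  set (u := goursat_sol phi q).
  assert (Cu : C0 u) by (apply C0_goursat_sol; auto).
  set (w := fun x y => q x y * u x y).
  assert (Cw : C0 w) by (apply C0_mult; auto).
  assert (Eu : u = fun x y => phi x y + I1 (I2 w) x y).
  { do 2 (apply functional_extensionality; intro); apply goursat_sol_fix; auto. }
  assert (Dy : dy (I2 w) = w).
  { do 2 (apply functional_extensionality; intro); apply is_derive_unique, I2_dy, Cw. }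
  assert (Ux : forall x y, is_derive (fun t => u t y) x (dx phi x y + I2 w x y)).
  { intros x y; rewrite Eu.
    apply (is_derive_plus (fun t => phi t y) (fun t => I1 (I2 w) t y)).
    - apply is_dx, smooth_diff1, Sphi.
    - apply I1_dx, C0_I2, Cw. }
  assert (Uy : forall x y, is_derive (fun t => u x t) y (dy phi x y + I1 w x y)).
  { intros x y; rewrite Eu.
    apply (is_derive_plus (fun t => phi x t) (fun t => I1 (I2 w) x t)).
    - apply is_dy, smooth_diff2, Sphi.
    - replace (I1 w x y) with (I1 (dy (I2 w)) x y) by (rewrite Dy; reflexivity).
      apply I1_dy.
      + apply C0_I2, Cw.
      + intros z t; exists (w z t); apply I2_dy, Cw.
      + rewrite Dy; exact Cw. }
  assert (Su : smooth_R2 u).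
  { intros k; change (Cn k u); induction k as [|k IH].
    - apply C0_Cn, Cu.
    - assert (Wk : Cn k w) by (apply Cn_mult; [exact (Hq k) | exact IH]).
      apply (Cn_of_partials k u _ _ Cu Ux Uy); apply Cn_plus.
      + exact (smooth_dx _ Sphi k).
      + apply Cn_I2, Wk.
      + exact (smooth_dy _ Sphi k).
      + apply Cn_I1, Wk. }
  exists u; repeat split; auto.
  - intros x y.
    replace (dy u) with (fun x y => dy phi x y + I1 w x y).
    2:{ do 2 (apply functional_extensionality; intro); symmetry; apply is_derive_unique, Uy. }
    apply is_derive_unique.
    replace (q x y * u x y) with (plus 0 (w x y)) by apply Rplus_0_l.
    apply (is_derive_plus (fun t => dy phi t y) (fun t => I1 w t y)).
    (* [dy phi] is the derivative of [b] alone, hence constant in the first variable. *)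
    + apply (is_derive_ext (fun _ => dy phi x y)); [|apply (is_derive_const (dy phi x y))].
      intros t; unfold dy, phi.
      rewrite !Derive_minus, !Derive_plus, !Derive_const; auto;
        try (apply (Hb 1%nat)); try apply ex_derive_const;
        (apply (ex_derive_plus (fun _ : R => a _) b); [apply ex_derive_const | apply (Hb 1%nat)]).
    + apply I1_dx, Cw.
  - intros x; rewrite Eu; unfold phi, I1, I2.
    rewrite (RInt_ext _ (fun _ => 0)).
    + rewrite RInt_const; change (a x + b 0 - a 0 + (x - 0) * 0 = a x); rewrite <- Hab; ring.
    + intros t _; apply RInt_0.
  - intros y; rewrite Eu; unfold phi, I1; rewrite RInt_0; ring.
Qed.

(** * Lelieuvre potentials and uniqueness *)

Lemma C0_restrict g : C0 g -> C0 (fun x _ => g x 0).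
Proof.
  intros H x y eps; destruct (H x 0 eps) as [d Hd].
  exists d; intros u v Hu _; apply Hd; auto.
  rewrite Rminus_diag, Rabs_R0; apply cond_pos.
Qed.

(** The path follows the [x]-axis and then goes vertically, so [dy F = w2] is immediate. Closedness
    enters in [dx F = w1]: the vertical integral of [dx w2 = dy w1] supplies the missing
    [w1 x y - w1 x 0]. *)
Lemma potential_exists (w1 w2 : R -> R -> R) c :
  smooth_R2 w1 -> smooth_R2 w2 -> dx w2 = dy w1 ->
  exists F, smooth_R2 F /\ dx F = w1 /\ dy F = w2 /\ F 0 0 = c.
Proof.
  intros H1 H2 E.
  set (F := fun x y => c + I1 (fun x _ => w1 x 0) x y + I2 w2 x y).
  pose proof (smooth_C0 _ H1) as C1; pose proof (smooth_C0 _ H2) as C2.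
  assert (Fy : forall x y, is_derive (fun t => F x t) y (w2 x y)).
  { intros x y; rewrite <- (Rplus_0_l (w2 x y)).
    apply (is_derive_plus (fun t => c + I1 (fun x _ => w1 x 0) x t) (fun t => I2 w2 x t)).
    - apply (is_derive_const (c + RInt (fun t => w1 t 0) 0 x)).
    - apply I2_dy, C2. }
  assert (Fx : forall x y, is_derive (fun t => F t y) x (w1 x y)).
  { intros x y; replace (w1 x y) with ((0 + w1 x 0) + I2 (dx w2) x y).
    - apply (is_derive_plus (fun t => c + I1 (fun x _ => w1 x 0) t y) (fun t => I2 w2 t y)).
      + apply (is_derive_plus (fun _ => c) (fun t => I1 (fun x _ => w1 x 0) t y)).
        * apply (is_derive_const c).
        * apply (I1_dx (fun x _ => w1 x 0)), C0_restrict, C1.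
      + apply I2_dx; [exact C2 | apply smooth_diff1, H2 | apply smooth_C0, smooth_dx, H2].
    - rewrite E; unfold I2, dy.
      rewrite (RInt_Derive (fun t => w1 x t)).
      + ring.
      + intros t _; apply (smooth_diff2 _ H1).
      + intros t _; apply (C0_slice2 (dy w1)), smooth_C0, smooth_dy, H1. }
  assert (CF : C0 F).
  { intros x y; apply continuity_2d_pt_plus; [apply continuity_2d_pt_plus|].
    - apply continuity_2d_pt_const.
    - apply C0_I1, C0_restrict, C1.
    - apply C0_I2, C2. }
  exists F; repeat split.
  - intros k; apply (Cn_pred k F), (Cn_of_partials k F w1 w2); auto; [exact (H1 k) | exact (H2 k)].
  - do 2 (apply functional_extensionality; intro); apply is_derive_unique, Fx.
  - do 2 (apply functional_extensionality; intro); apply is_derive_unique, Fy.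
  - unfold F, I1, I2; rewrite !RInt_0; ring.
Qed.

Lemma dx_mult f g x y : diff1 f -> diff1 g ->
  dx (fun x y => f x y * g x y) x y = dx f x y * g x y + f x y * dx g x y.
Proof. intros F G; apply (Derive_mult (fun t => f t y) (fun t => g t y)); auto. Qed.

Lemma dy_mult f g x y : diff2 f -> diff2 g ->
  dy (fun x y => f x y * g x y) x y = dy f x y * g x y + f x y * dy g x y.
Proof. intros F G; apply (Derive_mult (fun t => f x t) (fun t => g x t)); auto. Qed.

Lemma dx_minus f g x y : diff1 f -> diff1 g ->
  dx (fun x y => f x y - g x y) x y = dx f x y - dx g x y.
Proof. intros F G; apply (Derive_minus (fun t => f t y) (fun t => g t y)); auto. Qed.

Lemma dy_minus f g x y : diff2 f -> diff2 g ->
  dy (fun x y => f x y - g x y) x y = dy f x y - dy g x y.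
Proof. intros F G; apply (Derive_minus (fun t => f x t) (fun t => g x t)); auto. Qed.

(** The products of two first derivatives cancel. This is one coordinate of the identity that the
    second derivative of [f] in direction 1 is the cross product of that of [n] with [n], from which
    the asymptotic property follows. *)
Lemma dx_wronskian u v x y : smooth_R2 u -> smooth_R2 v ->
  dx (fun x y => dx u x y * v x y - dx v x y * u x y) x y =
  dx (dx u) x y * v x y - dx (dx v) x y * u x y.
Proof.
  intros Hu Hv.
  rewrite (dx_minus (fun x y => dx u x y * v x y) (fun x y => dx v x y * u x y)),
    (dx_mult (dx u) v), (dx_mult (dx v) u);
    auto using smooth_diff1, smooth_dx, smooth_mult.
  ring.
Qed.

Lemma dy_wronskian u v x y : smooth_R2 u -> smooth_R2 v ->
  dy (fun x y => u x y * dy v x y - v x y * dy u x y) x y =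
  u x y * dy (dy v) x y - v x y * dy (dy u) x y.
Proof.
  intros Hu Hv.
  rewrite (dy_minus (fun x y => u x y * dy v x y) (fun x y => v x y * dy u x y)),
    (dy_mult u (dy v)), (dy_mult v (dy u));
    auto using smooth_diff2, smooth_dy, smooth_mult.
  ring.
Qed.

(** From two coordinates [u], [v] of the normal one obtains the remaining coordinate [F] of the
    surface. The form is closed because both satisfy the Moutard equation with the same [q], so that
    the terms [q u v] cancel. *)
Lemma lelieuvre_potential (q u v : R -> R -> R) c :
  smooth_R2 u -> smooth_R2 v ->
  (forall x y, dx (dy u) x y = q x y * u x y) ->
  (forall x y, dx (dy v) x y = q x y * v x y) ->
  exists F, smooth_R2 F /\
    dx F = (fun x y => dx u x y * v x y - dx v x y * u x y) /\
    dy F = (fun x y => u x y * dy v x y - v x y * dy u x y) /\ F 0 0 = c.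
Proof.
  intros Hu Hv Eu Ev.
  apply potential_exists.
  - apply smooth_minus; apply smooth_mult; auto using smooth_dx.
  - apply smooth_minus; apply smooth_mult; auto using smooth_dy.
  - apply functional_extensionality; intros x; apply functional_extensionality; intros y.
    rewrite (dx_minus (fun x y => u x y * dy v x y) (fun x y => v x y * dy u x y)),
      (dx_mult u (dy v)), (dx_mult v (dy u)),
      (dy_minus (fun x y => dx u x y * v x y) (fun x y => dx v x y * u x y)),
      (dy_mult (dx u) v), (dy_mult (dx v) u), !smooth_schwarz, Eu, Ev;
      auto 7 using smooth_diff1, smooth_diff2, smooth_dx, smooth_dy, smooth_mult.
    ring.
Qed.

(** Integrating the equation twice from the axes improves any bound [M]: the first integration
    halves it by [K r <= 1/2], the second preserves it by [r <= 1]. *)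
Lemma goursat_halve (q w : R -> R -> R) r K M :
  0 < r <= 1 -> 0 <= K -> K * r <= / 2 -> 0 <= M -> smooth_R2 w ->
  (forall x y, in_square r x y -> Rabs (q x y) <= K) ->
  (forall x y, in_square r x y -> dx (dy w) x y = q x y * w x y) ->
  (forall x, 0 <= x <= r -> w x 0 = 0) -> (forall y, 0 <= y <= r -> w 0 y = 0) ->
  (forall x y, in_square r x y -> Rabs (w x y) <= M) ->
  forall x y, in_square r x y -> Rabs (w x y) <= M / 2.
Proof.
  intros Hr HK HKr HM Hw Q E W1 W2 B x y [Hx Hy].
  assert (D : forall t, 0 < t < y -> Rabs (dy w x t) <= M / 2).
  { intros t Ht.
    (* The values on the [y]-axis are known only for [0 <= y <= r], so the two-sided derivative is
       determined only at inner points; hence the range [0 < t < y]. *)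
    assert (Z : dy w 0 t = 0).
    { unfold dy; rewrite (Derive_ext_loc _ (fun _ => 0)); [apply Derive_const|].
      assert (P : 0 < Rmin t (r - t)) by (apply Rmin_pos; lra).
      exists (mkposreal _ P); intros s Hs; apply W2.
      change (Rabs (s - t) < Rmin t (r - t)) in Hs.
      apply Rabs_lt_between in Hs.
      pose proof (Rmin_l t (r - t)); pose proof (Rmin_r t (r - t)); lra. }
    replace (dy w x t) with (dy w x t - dy w 0 t) by lra.
    apply Rle_trans with (K * M * Rabs (x - 0)).
    - apply (mvt_bound (fun s => dy w s t) (fun s => dx (dy w) s t)).
      + intros s _; apply (is_dx (dy w)), smooth_diff1, smooth_dy, Hw.
      + intros s _; apply (C0_slice1 (dy w)), smooth_C0, smooth_dy, Hw.
      + rewrite Rmin_left, Rmax_right by lra; intros s Hs.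
        assert (S : in_square r s t) by (split; lra).
        rewrite (E s t S), Rabs_mult; apply Rmult_le_compat; auto using Rabs_pos.
      + apply Rmult_le_pos; auto.
    - rewrite Rminus_0_r, Rabs_pos_eq by lra.
      apply Rle_trans with (K * M * r).
      + apply Rmult_le_compat_l; [apply Rmult_le_pos; auto | lra].
      + replace (K * M * r) with (K * r * M) by ring.
        apply Rle_trans with (/ 2 * M); [apply Rmult_le_compat_r; auto | lra]. }
  replace (w x y) with (w x y - w x 0) by (rewrite W1; [ring | lra]).
  apply Rle_trans with (M / 2 * Rabs (y - 0)).
  - apply (mvt_bound (fun s => w x s) (fun s => dy w x s)).
    + intros s _; apply is_dy, smooth_diff2, Hw.
    + intros s _; apply (C0_slice2 w), smooth_C0, Hw.
    + rewrite Rmin_left, Rmax_right by lra; auto.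
    + lra.
  - rewrite Rminus_0_r, Rabs_pos_eq by lra.
    rewrite <- (Rmult_1_r (M / 2)) at 2; apply Rmult_le_compat_l; lra.
Qed.

(** The difference solves the homogeneous problem, so its bound on the square can be halved
    arbitrarily often. *)
Lemma goursat_unique (q u v : R -> R -> R) r K :
  0 < r <= 1 -> 0 <= K -> K * r <= / 2 -> smooth_R2 u -> smooth_R2 v ->
  (forall x y, in_square r x y -> Rabs (q x y) <= K) ->
  (forall x y, in_square r x y -> dx (dy u) x y = q x y * u x y) ->
  (forall x y, in_square r x y -> dx (dy v) x y = q x y * v x y) ->
  (forall x, 0 <= x <= r -> u x 0 = v x 0) -> (forall y, 0 <= y <= r -> u 0 y = v 0 y) ->
  forall x y, in_square r x y -> u x y = v x y.
Proof.
  intros Hr HK HKr Hu Hv Q Eu Ev U1 U2.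
  set (w := fun x y => u x y - v x y).
  assert (Hw : smooth_R2 w) by (apply smooth_minus; auto).
  destruct (C0_bounded w 0 r (smooth_C0 _ Hw)) as (M & HM & B).
  assert (P : forall k x y, in_square r x y -> Rabs (w x y) <= M / 2 ^ k).
  { induction k as [|k IH].
    - intros x y [Hx Hy]; simpl; rewrite Rdiv_1_r; auto.
    - intros x y Sq.
      pose proof (pow_lt 2 k ltac:(lra)) as P2.
      replace (M / 2 ^ S k) with (M / 2 ^ k / 2) by (simpl; field; lra).
      apply (goursat_halve q w r K); auto.
      + apply Rmult_le_pos; [auto | left; apply Rinv_0_lt_compat, P2].
      + clear x y Sq; intros x y Sq.
        assert (E : dy w = fun x y => dy u x y - dy v x y).
        { do 2 (apply functional_extensionality; intro); apply dy_minus;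
            apply smooth_diff2; auto. }
        rewrite E, (dx_minus (dy u) (dy v)), Eu, Ev by
          auto using smooth_diff1, smooth_dy.
        unfold w; ring.
      + intros s Hs; unfold w; rewrite U1; auto; ring.
      + intros s Hs; unfold w; rewrite U2; auto; ring. }
  intros x y S; apply Rminus_diag_uniq, Rabs_eq_0, Rle_antisym; [|apply Rabs_pos].
  change (Rabs (w x y) <= 0).
  apply le_epsilon; intros e He; rewrite Rplus_0_l.
  destruct (pow_lt_1_zero (/ 2) ltac:(rewrite Rabs_pos_eq; lra) (e / (M + 1))
              ltac:(apply Rdiv_lt_0_compat; lra)) as [N HN].
  specialize (HN N (le_n N)); specialize (P N x y S).
  rewrite pow_inv in HN.
  pose proof (pow_lt 2 N ltac:(lra)) as P2.
  rewrite Rabs_pos_eq in HN by (left; apply Rinv_0_lt_compat, P2).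
  apply Rle_trans with (1 := P).
  apply Rle_trans with ((M + 1) * / 2 ^ N).
  - apply Rmult_le_compat_r; [left; apply Rinv_0_lt_compat, P2 | lra].
  - replace e with ((M + 1) * (e / (M + 1))) by (field; lra).
    apply Rmult_le_compat_l; lra.
Qed.

Lemma Derive_local_eq (f g : R -> R) r x : 0 < x < r ->
  (forall s, 0 <= s <= r -> f s = g s) -> Derive f x = Derive g x.
Proof.
  intros Hx H; apply Derive_ext_loc.
  assert (P : 0 < Rmin x (r - x)) by (apply Rmin_pos; lra).
  exists (mkposreal _ P); intros s Hs; apply H.
  change (Rabs (s - x) < Rmin x (r - x)) in Hs.
  apply Rabs_lt_between in Hs.
  pose proof (Rmin_l x (r - x)); pose proof (Rmin_r x (r - x)); lra.
Qed.

(** The difference is constant along the path from the origin up the [y]-axis and then parallel to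
    the [x]-axis. Derivatives are compared at inner points of these segments, where values on the
    square determine them. *)
Lemma potential_unique (F G : R -> R -> R) r : smooth_R2 F -> smooth_R2 G ->
  (forall x y, 0 < x < r -> 0 <= y <= r -> dx F x y = dx G x y) ->
  (forall y, 0 < y < r -> dy F 0 y = dy G 0 y) -> F 0 0 = G 0 0 ->
  forall x y, in_square r x y -> F x y = G x y.
Proof.
  intros HF HG E1 E2 E0 x y [Hx Hy].
  set (w := fun x y => F x y - G x y).
  assert (Hw : smooth_R2 w) by (apply smooth_minus; auto).
  assert (L1 : Rabs (w 0 y - w 0 0) <= 0 * Rabs (y - 0)).
  { apply (mvt_bound (fun s => w 0 s) (fun s => dy w 0 s)); try lra.
    + intros s _; apply is_dy, smooth_diff2, Hw.
    + intros s _; apply (C0_slice2 w), smooth_C0, Hw.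
    + rewrite Rmin_left, Rmax_right by lra; intros s Hs.
      unfold w; rewrite dy_minus, E2, Rminus_diag, Rabs_R0
        by (auto using smooth_diff2; lra); lra. }
  assert (L2 : Rabs (w x y - w 0 y) <= 0 * Rabs (x - 0)).
  { apply (mvt_bound (fun s => w s y) (fun s => dx w s y)); try lra.
    + intros s _; apply is_dx, smooth_diff1, Hw.
    + intros s _; apply (C0_slice1 w), smooth_C0, Hw.
    + rewrite Rmin_left, Rmax_right by lra; intros s Hs.
      unfold w; rewrite dx_minus, E1, Rminus_diag, Rabs_R0
        by (auto using smooth_diff1; lra); lra. }
  rewrite Rmult_0_l in L1, L2.
  apply Rabs_le_between in L1; apply Rabs_le_between in L2.
  unfold w in L1, L2; lra.
Qed.

(** * Lattice families and their difference quotients *)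

(** The mesh [eps] is an argument, so that one statement can express uniformity in it. Natural
    indices suffice because the square lies in the first quadrant. *)
Definition gridfam := R -> nat -> nat -> R.

Definition FD1 (U : gridfam) : gridfam :=
  fun eps i j => / eps * (U eps (S i) j - U eps i j).
Definition FD2 (U : gridfam) : gridfam :=
  fun eps i j => / eps * (U eps i (S j) - U eps i j).
Definition sh1 (U : gridfam) : gridfam := fun eps i j => U eps (S i) j.
Definition sh2 (U : gridfam) : gridfam := fun eps i j => U eps i (S j).
Definition smp (h : R -> R -> R) : gridfam :=
  fun eps i j => h (eps * INR i) (eps * INR j).

Lemma gridfam_ext (U V : gridfam) : (forall eps i j, U eps i j = V eps i j) -> U = V.
Proof. intros H; do 3 (apply functional_extensionality; intro); apply H. Qed.

Lemma FD12 U : FD1 (FD2 U) = FD2 (FD1 U).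
Proof. apply gridfam_ext; intros; unfold FD1, FD2; ring. Qed.

Section Estimates.

Variable r : R.

Definition dom (p q : nat) (eps : R) (i j : nat) : Prop :=
  0 < eps /\ eps * INR (i + p) <= r /\ eps * INR (j + q) <= r.

Definition sup (k p q : nat) (U : gridfam) : Prop :=
  exists c e0, 0 < e0 /\ forall eps i j, eps < e0 -> dom p q eps i j ->
    Rabs (U eps i j) <= c * eps ^ k.

(* [U] and its difference quotients of order at most [N] are [O(eps^k)].  The margins
   [p], [q] say that [U eps i j] itself only makes sense when the lattice points with
   indices [i + p] and [j + q] still lie in [[0, r]]. *)
Fixpoint bnd (N k p q : nat) (U : gridfam) : Prop :=
  sup k p q U /\
  match N with
  | 0%nat => True
  | S N => bnd N k (S p) q (FD1 U) /\ bnd N k p (S q) (FD2 U)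
  end.

Lemma bnd_sup N k p q U : bnd N k p q U -> sup k p q U.
Proof. destruct N; intros H; apply H. Qed.

Lemma dom_le p q p' q' eps i j i' j' : dom p q eps i j ->
  (i' + p' <= i + p)%nat -> (j' + q' <= j + q)%nat -> dom p' q' eps i' j'.
Proof.
  intros (H0 & H1 & H2) Hi Hj.
  apply le_INR in Hi; apply le_INR in Hj.
  repeat split; auto.
  - apply Rle_trans with (2 := H1), Rmult_le_compat_l; lra.
  - apply Rle_trans with (2 := H2), Rmult_le_compat_l; lra.
Qed.

Lemma bnd_ext N : forall k p q U V,
  (forall eps i j, dom p q eps i j -> U eps i j = V eps i j) ->
  bnd N k p q U -> bnd N k p q V.
Proof.
  induction N as [|N IH]; intros k p q U V E H;
    (split; [destruct (bnd_sup _ _ _ _ _ H) as (c & e0 & He & B);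
      exists c, e0; split; auto; intros eps i j Hs Hd; rewrite <- E; auto|]).
  - trivial.
  - destruct H as (_ & H1 & H2); split.
    + apply (IH _ _ _ (FD1 U)); auto; intros eps i j Hd; unfold FD1.
      rewrite !E; auto; apply (dom_le _ _ _ _ _ _ _ _ _ Hd); lia.
    + apply (IH _ _ _ (FD2 U)); auto; intros eps i j Hd; unfold FD2.
      rewrite !E; auto; apply (dom_le _ _ _ _ _ _ _ _ _ Hd); lia.
Qed.

Lemma sup_weaken k p q p' q' U : (p <= p')%nat -> (q <= q')%nat ->
  sup k p q U -> sup k p' q' U.
Proof.
  intros Hp Hq (c & e0 & He & B); exists c, e0; split; auto.
  intros eps i j Hs Hd; apply B; auto; apply (dom_le _ _ _ _ _ _ _ _ _ Hd); lia.
Qed.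

Lemma bnd_weaken N : forall k p q p' q' U, (p <= p')%nat -> (q <= q')%nat ->
  bnd N k p q U -> bnd N k p' q' U.
Proof.
  induction N as [|N IH]; intros k p q p' q' U Hp Hq H;
    (split; [apply (sup_weaken k p q), (bnd_sup _ _ _ _ _ H); auto|]).
  - trivial.
  - destruct H as (_ & H1 & H2); split;
      [apply (IH k (S p) q) | apply (IH k p (S q))]; auto; lia.
Qed.

Lemma bnd_pred N : forall k p q U, bnd (S N) k p q U -> bnd N k p q U.
Proof.
  induction N as [|N IH]; intros k p q U H.
  - split; [apply H | trivial].
  - split; [apply H|]; split; apply IH, H.
Qed.

Lemma sup_order k p q U : sup (S k) p q U -> sup k p q U.
Proof.
  intros (c & e0 & He & B); exists (Rabs c), (Rmin 1 e0); split.
  { apply Rmin_pos; lra. }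
  intros eps i j Hs Hd.
  pose proof (Rmin_l 1 e0); pose proof (Rmin_r 1 e0).
  pose proof Hd as (Hp & _).
  pose proof (pow_lt eps k Hp) as Pk.
  eapply Rle_trans; [apply B; auto; lra|].
  simpl; apply Rle_trans with (Rabs c * (eps * eps ^ k)).
  - apply Rmult_le_compat_r; [nra | apply Rle_abs].
  - apply Rmult_le_compat_l; [apply Rabs_pos | nra].
Qed.

Lemma bnd_order N : forall k p q U, bnd N (S k) p q U -> bnd N k p q U.
Proof.
  induction N as [|N IH]; intros k p q U H;
    (split; [apply sup_order, (bnd_sup _ _ _ _ _ H)|]).
  - trivial.
  - destruct H as (_ & H1 & H2); split; apply IH; auto.
Qed.

Lemma bnd_sh1 N : forall k p q U, bnd N k p q U -> bnd N k (S p) q (sh1 U).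
Proof.
  induction N as [|N IH]; intros k p q U H;
    (split; [destruct (bnd_sup _ _ _ _ _ H) as (c & e0 & He & B);
      exists c, e0; split; auto; intros eps i j Hs Hd; apply B; auto;
      apply (dom_le _ _ _ _ _ _ _ _ _ Hd); lia|]).
  - trivial.
  - destruct H as (_ & H1 & H2); split.
    + apply (IH k (S p) q (FD1 U)), H1.
    + apply (IH k p (S q) (FD2 U)), H2.
Qed.

Lemma bnd_sh2 N : forall k p q U, bnd N k p q U -> bnd N k p (S q) (sh2 U).
Proof.
  induction N as [|N IH]; intros k p q U H;
    (split; [destruct (bnd_sup _ _ _ _ _ H) as (c & e0 & He & B);
      exists c, e0; split; auto; intros eps i j Hs Hd; apply B; auto;
      apply (dom_le _ _ _ _ _ _ _ _ _ Hd); lia|]).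
  - trivial.
  - destruct H as (_ & H1 & H2); split.
    + apply (IH k (S p) q (FD1 U)), H1.
    + apply (IH k p (S q) (FD2 U)), H2.
Qed.

Lemma sup_plus k p q U V : sup k p q U -> sup k p q V ->
  sup k p q (fun eps i j => U eps i j + V eps i j).
Proof.
  intros (c & e0 & He & B) (c' & e0' & He' & B').
  exists (c + c'), (Rmin e0 e0'); split; [apply Rmin_pos; auto|].
  intros eps i j Hs Hd; pose proof (Rmin_l e0 e0'); pose proof (Rmin_r e0 e0').
  eapply Rle_trans; [apply Rabs_triang|].
  rewrite Rmult_plus_distr_r; apply Rplus_le_compat; [apply B | apply B']; auto; lra.
Qed.

Lemma bnd_plus N : forall k p q U V, bnd N k p q U -> bnd N k p q V ->
  bnd N k p q (fun eps i j => U eps i j + V eps i j).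
Proof.
  induction N as [|N IH]; intros k p q U V HU HV;
    (split; [apply sup_plus; eapply bnd_sup; eassumption|]).
  - trivial.
  - destruct HU as (_ & U1 & U2), HV as (_ & V1 & V2); split.
    + eapply bnd_ext; [|apply (IH _ _ _ _ _ U1 V1)].
      intros; unfold FD1; ring.
    + eapply bnd_ext; [|apply (IH _ _ _ _ _ U2 V2)].
      intros; unfold FD2; ring.
Qed.

Lemma sup_mult k l p q U V : sup k p q U -> sup l p q V ->
  sup (k + l) p q (fun eps i j => U eps i j * V eps i j).
Proof.
  intros (c & e0 & He & B) (c' & e0' & He' & B').
  exists (c * c'), (Rmin e0 e0'); split; [apply Rmin_pos; auto|].
  intros eps i j Hs Hd; pose proof (Rmin_l e0 e0'); pose proof (Rmin_r e0 e0').
  rewrite Rabs_mult, pow_add.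
  replace (c * c' * (eps ^ k * eps ^ l)) with ((c * eps ^ k) * (c' * eps ^ l)) by ring.
  apply Rmult_le_compat; try apply Rabs_pos; [apply B | apply B']; auto; lra.
Qed.

(** Discrete Leibniz rule: the quotient of [U V] is the quotient of [U] times the shifted [V] plus
    [U] times the quotient of [V]. The orders in [eps] add up. *)
Lemma bnd_mult N : forall k l p q U V, bnd N k p q U -> bnd N l p q V ->
  bnd N (k + l) p q (fun eps i j => U eps i j * V eps i j).
Proof.
  induction N as [|N IH]; intros k l p q U V HU HV;
    (split; [apply sup_mult; eapply bnd_sup; eassumption|]).
  - trivial.
  - pose proof (bnd_pred _ _ _ _ _ HU) as U0; pose proof (bnd_pred _ _ _ _ _ HV) as V0.
    destruct HU as (_ & U1 & U2), HV as (_ & V1 & V2); split.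
    + eapply bnd_ext; [|apply (bnd_plus N _ _ _ _ _
        (IH _ _ _ _ _ _ U1 (bnd_sh1 _ _ _ _ _ V0))
        (IH _ _ _ _ _ _ (bnd_weaken _ _ _ _ (S p) q _ (le_S _ _ (le_n p)) (le_n q) U0) V1))].
      intros; unfold FD1, sh1; ring.
    + eapply bnd_ext; [|apply (bnd_plus N _ _ _ _ _
        (IH _ _ _ _ _ _ U2 (bnd_sh2 _ _ _ _ _ V0))
        (IH _ _ _ _ _ _ (bnd_weaken _ _ _ _ p (S q) _ (le_n p) (le_S _ _ (le_n q)) U0) V2))].
      intros; unfold FD2, sh2; ring.
Qed.

Lemma bnd_zero N : forall k p q, bnd N k p q (fun _ _ _ => 0).
Proof.
  induction N as [|N IH]; intros k p q;
    (split; [exists 0, 1; split; [lra|]; intros; rewrite Rabs_R0, Rmult_0_l; apply Rle_refl|]).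
  - trivial.
  - split; (eapply bnd_ext; [|apply IH]); intros; unfold FD1, FD2; ring.
Qed.

Lemma bnd_cst N k p q c : bnd N k p q (fun eps _ _ => c * eps ^ k).
Proof.
  assert (B : sup k p q (fun eps _ _ => c * eps ^ k)).
  { exists (Rabs c), 1; split; [lra|]; intros eps i j _ (Hp & _).
    rewrite Rabs_mult, (Rabs_pos_eq (eps ^ k)) by (apply pow_le; lra).
    apply Rle_refl. }
  destruct N as [|N]; split; auto.
  split; (eapply bnd_ext; [|apply bnd_zero]); intros; unfold FD1, FD2; ring.
Qed.

Lemma bnd_scal N k p q c U : bnd N k p q U -> bnd N k p q (fun eps i j => c * U eps i j).
Proof.
  intros H; eapply bnd_ext; [|apply (bnd_mult N 0 k p q _ _ (bnd_cst N 0 p q c) H)].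
  intros; simpl; ring.
Qed.

Lemma bnd_eps N k p q U : bnd N k p q U -> bnd N (S k) p q (fun eps i j => eps * U eps i j).
Proof.
  intros H; eapply bnd_ext; [|apply (bnd_mult N 1 k p q _ _ (bnd_cst N 1 p q 1) H)].
  intros; simpl; ring.
Qed.

Lemma bnd_minus N k p q U V : bnd N k p q U -> bnd N k p q V ->
  bnd N k p q (fun eps i j => U eps i j - V eps i j).
Proof.
  intros HU HV; eapply bnd_ext; [|apply (bnd_plus N k p q _ _ HU (bnd_scal _ _ _ _ (-1) _ HV))].
  intros; simpl; ring.
Qed.

(** [A B - a b = (A - a) (B - b) + (A - a) b + a (B - b)]. In the first product one factor is
    weakened to [O(1)], which leaves the order 1 asked for. *)
Lemma bnd_product_error N p q A B a b :
  bnd N 1 p q (fun eps i j => A eps i j - a eps i j) ->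
  bnd N 1 p q (fun eps i j => B eps i j - b eps i j) ->
  bnd N 0 p q a -> bnd N 0 p q b ->
  bnd N 1 p q (fun eps i j => A eps i j * B eps i j - a eps i j * b eps i j).
Proof.
  intros HA HB Ha Hb.
  pose proof (bnd_mult _ _ _ _ _ _ _ (bnd_order _ _ _ _ _ HA) HB) as H1.
  pose proof (bnd_mult _ _ _ _ _ _ _ HA Hb) as H2.
  pose proof (bnd_mult _ _ _ _ _ _ _ Ha HB) as H3.
  eapply bnd_ext; [|apply (bnd_plus _ _ _ _ _ _ (bnd_plus _ _ _ _ _ _ H1 H2) H3)].
  intros; simpl; ring.
Qed.

(** Every quotient raises the margin of its direction by one, so the final margins describe the
    nodes at which the iterated quotient is defined. *)
Lemma bnd_iter k U a : forall b p q, bnd (a + b) k p q U ->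
  sup k (p + a) (q + b) (Nat.iter a FD1 (Nat.iter b FD2 U)).
Proof.
  assert (P : forall b U p q N, bnd (N + b) k p q U -> bnd N k p (q + b) (Nat.iter b FD2 U)).
  { clear; induction b as [|b IH]; intros U p q N H.
    - rewrite Nat.add_0_r in *; exact H.
    - rewrite Nat.iter_succ_r; replace (q + S b)%nat with (S q + b)%nat by lia.
      apply IH; rewrite Nat.add_succ_r in H; apply H. }
  assert (Q : forall a U p q, bnd a k p q U -> sup k (p + a) q (Nat.iter a FD1 U)).
  { clear; induction a as [|a IH]; intros U p q H.
    - rewrite Nat.add_0_r; apply (bnd_sup _ _ _ _ _ H).
    - rewrite Nat.iter_succ_r; replace (p + S a)%nat with (S p + a)%nat by lia.
      apply IH, H. }
  intros b p q H; apply Q, P, H.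
Qed.

Lemma row_sum_bound (w : nat -> R) eps c n : 0 < eps -> w 0%nat = 0 ->
  (forall j, (j < n)%nat -> Rabs (/ eps * (w (S j) - w j)) <= c) ->
  Rabs (w n) <= eps * INR n * c.
Proof.
  intros He W0; induction n as [|n IH]; intros H.
  - rewrite W0, Rabs_R0; simpl; lra.
  - replace (w (S n)) with (eps * (/ eps * (w (S n) - w n)) + w n) by (field; lra).
    eapply Rle_trans; [apply Rabs_triang|].
    rewrite Rabs_mult, (Rabs_pos_eq eps) by lra.
    specialize (IH (fun j Hj => H j (le_S _ _ Hj))); specialize (H n (le_n _)).
    rewrite S_INR.
    apply (Rmult_le_compat_l eps) in H; [|lra]; lra.
Qed.

Lemma sup_sum2 k p q W :
  (forall eps i, dom p q eps i 0 -> W eps i 0%nat = 0) ->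
  sup k p (S q) (FD2 W) -> sup k p q W.
Proof.
  intros W0 (c & e0 & He & B); exists (r * Rabs c), e0; split; auto.
  intros eps i j Hs Hd; pose proof Hd as (Hp & Hi & Hj).
  pose proof (pow_lt eps k Hp) as Pk.
  assert (X : Rabs (W eps i j) <= eps * INR j * (Rabs c * eps ^ k)).
  { apply (row_sum_bound (fun j => W eps i j)); auto.
    - apply W0, (dom_le _ _ _ _ _ _ _ _ _ Hd); lia.
    - intros j' Hj'; eapply Rle_trans; [apply (B eps i j'); auto|].
      + apply (dom_le _ _ _ _ _ _ _ _ _ Hd); lia.
      + apply Rmult_le_compat_r; [lra | apply Rle_abs]. }
  eapply Rle_trans; [exact X|]. rewrite (Rmult_assoc r); apply Rmult_le_compat_r.
  - apply Rmult_le_pos; [apply Rabs_pos | lra].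
  - apply Rle_trans with (2 := Hj), Rmult_le_compat_l; [lra | apply le_INR; lia].
Qed.

Lemma sup_sum1 k p q W :
  (forall eps j, dom p q eps 0 j -> W eps 0%nat j = 0) ->
  sup k (S p) q (FD1 W) -> sup k p q W.
Proof.
  intros W0 (c & e0 & He & B); exists (r * Rabs c), e0; split; auto.
  intros eps i j Hs Hd; pose proof Hd as (Hp & Hi & Hj).
  pose proof (pow_lt eps k Hp) as Pk.
  assert (X : Rabs (W eps i j) <= eps * INR i * (Rabs c * eps ^ k)).
  { apply (row_sum_bound (fun i => W eps i j)); auto.
    - apply W0, (dom_le _ _ _ _ _ _ _ _ _ Hd); lia.
    - intros i' Hi'; eapply Rle_trans; [apply (B eps i' j); auto|].
      + apply (dom_le _ _ _ _ _ _ _ _ _ Hd); lia.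
      + apply Rmult_le_compat_r; [lra | apply Rle_abs]. }
  eapply Rle_trans; [exact X|]. rewrite (Rmult_assoc r); apply Rmult_le_compat_r.
  - apply Rmult_le_pos; [apply Rabs_pos | lra].
  - apply Rle_trans with (2 := Hi), Rmult_le_compat_l; [lra | apply le_INR; lia].
Qed.

(* Summation loses no order of difference quotients: those in direction 1 commute with
   the sum, and those in direction 2 undo it. *)
Lemma bnd_sum2 N : forall k p q W,
  (forall eps i, dom p q eps i 0 -> W eps i 0%nat = 0) ->
  bnd N k p (S q) (FD2 W) -> bnd N k p q W.
Proof.
  induction N as [|N IH]; intros k p q W W0 H;
    (split; [apply sup_sum2, (bnd_sup _ _ _ _ _ H); auto|]).
  - trivial.
  - split.
    + apply IH.
      * intros eps i Hd; unfold FD1; rewrite !W0; [ring| |];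
          apply (dom_le _ _ _ _ _ _ _ _ _ Hd); lia.
      * rewrite <- FD12; apply H.
    + apply bnd_pred, H.
Qed.

Lemma bnd_sum1 N : forall k p q W,
  (forall eps j, dom p q eps 0 j -> W eps 0%nat j = 0) ->
  bnd N k (S p) q (FD1 W) -> bnd N k p q W.
Proof.
  induction N as [|N IH]; intros k p q W W0 H;
    (split; [apply sup_sum1, (bnd_sup _ _ _ _ _ H); auto|]).
  - trivial.
  - split.
    + apply bnd_pred, H.
    + apply IH.
      * intros eps i Hd; unfold FD2; rewrite !W0; [ring| |];
          apply (dom_le _ _ _ _ _ _ _ _ _ Hd); lia.
      * rewrite FD12; apply H.
Qed.

(** For a function known only at the origin, as the surface error is: sum along the [x]-axis, then
    up each column. *)
Lemma sup_from_origin k W :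
  (forall eps, 0 < eps -> W eps 0%nat 0%nat = 0) ->
  sup k 1 0 (FD1 W) -> sup k 0 1 (FD2 W) -> sup k 0 0 W.
Proof.
  intros W0 H1 H2.
  assert (A : sup k 0 0 (fun eps i _ => W eps i 0%nat)).
  { apply sup_sum1.
    - intros eps j (Hp & _); apply W0, Hp.
    - destruct H1 as (c & e0 & He & B); exists c, e0; split; auto.
      intros eps i j Hs Hd; apply (B eps i 0%nat Hs), (dom_le _ _ _ _ _ _ _ _ _ Hd); lia. }
  assert (A' : sup k 0 0 (fun eps i j => W eps i j - W eps i 0%nat)).
  { apply sup_sum2.
    - intros; ring.
    - destruct H2 as (c & e0 & He & B); exists c, e0; split; auto.
      intros eps i j Hs Hd; unfold FD2.
      replace (W eps i (S j) - W eps i 0%nat - (W eps i j - W eps i 0%nat)) with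
        (W eps i (S j) - W eps i j) by ring.
      apply (B eps i j Hs Hd). }
  pose proof (sup_plus _ _ _ _ _ A A') as (c & e0 & He & B).
  exists c, e0; split; auto; intros eps i j Hs Hd.
  replace (W eps i j) with (W eps i 0%nat + (W eps i j - W eps i 0%nat)) by ring.
  apply (B eps i j Hs Hd).
Qed.

End Estimates.

(** * Consistency and convergence *)

Definition fdx (eps : R) (g : R -> R -> R) (x y : R) : R := / eps * (g (x + eps) y - g x y).
Definition fdy (eps : R) (g : R -> R -> R) (x y : R) : R := / eps * (g x (y + eps) - g x y).

Lemma mvt_quotient (h h' : R -> R) x eps M : 0 < eps ->
  (forall s, is_derive h s (h' s)) ->
  (forall s, x <= s <= x + eps -> Rabs (h' s) <= M) ->
  Rabs (/ eps * (h (x + eps) - h x)) <= M.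
Proof.
  intros He H B.
  assert (HM : 0 <= M) by (eapply Rle_trans; [apply Rabs_pos | apply (B x); lra]).
  assert (L : Rabs (h (x + eps) - h x) <= M * Rabs (x + eps - x)).
  { apply (mvt_bound h h'); auto.
    - intros s _; apply (ex_derive_continuous h); exists (h' s); apply H.
    - rewrite Rmin_left, Rmax_right by lra; intros s Hs; apply B; lra. }
  replace (x + eps - x) with eps in L by ring.
  rewrite (Rabs_pos_eq eps) in L by lra.
  rewrite Rabs_mult, (Rabs_pos_eq (/ eps)) by (left; apply Rinv_0_lt_compat, He).
  apply (Rmult_le_reg_l eps); [exact He|].
  rewrite <- Rmult_assoc, Rinv_r, Rmult_1_l by lra; lra.
Qed.

Lemma is_derive_shift (h : R -> R) x eps l : is_derive h (x + eps) l ->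
  is_derive (fun t => h (t + eps)) x l.
Proof.
  intros H; replace l with (scal 1 l) by apply Rmult_1_l.
  apply (is_derive_comp h (fun t => t + eps)); [exact H|].
  replace 1 with (1 + 0) by ring.
  apply (is_derive_plus (fun t : R => t) (fun _ => eps));
    [apply (is_derive_id x) | apply (is_derive_const eps)].
Qed.

Lemma is_derive_quotient (h1 h2 : R -> R) x l1 l2 eps :
  is_derive h1 x l1 -> is_derive h2 x l2 ->
  is_derive (fun t => / eps * (h1 t - h2 t)) x (/ eps * (l1 - l2)).
Proof.
  intros H1 H2; apply (is_derive_scal (fun t => h1 t - h2 t)).
  apply (is_derive_minus h1 h2); auto.
Qed.

Lemma is_dx_fdx eps g x y : diff1 g -> is_derive (fun t => fdx eps g t y) x (fdx eps (dx g) x y).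
Proof.
  intros H; apply (is_derive_quotient (fun t => g (t + eps) y) (fun t => g t y)).
  - apply (is_derive_shift (fun t => g t y)), is_dx, H.
  - apply is_dx, H.
Qed.

Lemma is_dy_fdx eps g x y : diff2 g -> is_derive (fun t => fdx eps g x t) y (fdx eps (dy g) x y).
Proof.
  intros H; apply (is_derive_quotient (fun t => g (x + eps) t) (fun t => g x t)); apply is_dy, H.
Qed.

Lemma is_dx_fdy eps g x y : diff1 g -> is_derive (fun t => fdy eps g t y) x (fdy eps (dx g) x y).
Proof.
  intros H; apply (is_derive_quotient (fun t => g t (y + eps)) (fun t => g t y)); apply is_dx, H.
Qed.

Lemma is_dy_fdy eps g x y : diff2 g -> is_derive (fun t => fdy eps g x t) y (fdy eps (dy g) x y).
Proof.
  intros H; apply (is_derive_quotient (fun t => g x (t + eps)) (fun t => g x t)).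
  - apply (is_derive_shift (fun t => g x t)), is_dy, H.
  - apply is_dy, H.
Qed.

Lemma d_ext (D : (R -> R -> R) -> R -> R -> R) g g' : (forall x y, D g x y = g' x y) -> D g = g'.
Proof. intros H; do 2 (apply functional_extensionality; intro); apply H. Qed.

Lemma dx_fdx eps g : diff1 g -> dx (fdx eps g) = fdx eps (dx g).
Proof. intros H; apply (d_ext dx); intros; apply is_derive_unique, is_dx_fdx, H. Qed.
Lemma dy_fdx eps g : diff2 g -> dy (fdx eps g) = fdx eps (dy g).
Proof. intros H; apply (d_ext dy); intros; apply is_derive_unique, is_dy_fdx, H. Qed.
Lemma dx_fdy eps g : diff1 g -> dx (fdy eps g) = fdy eps (dx g).
Proof. intros H; apply (d_ext dx); intros; apply is_derive_unique, is_dx_fdy, H. Qed.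
Lemma dy_fdy eps g : diff2 g -> dy (fdy eps g) = fdy eps (dy g).
Proof. intros H; apply (d_ext dy); intros; apply is_derive_unique, is_dy_fdy, H. Qed.

Lemma diff1_fdx eps g : diff1 g -> diff1 (fdx eps g).
Proof. intros H x y; eexists; apply is_dx_fdx, H. Qed.
Lemma diff2_fdx eps g : diff2 g -> diff2 (fdx eps g).
Proof. intros H x y; eexists; apply is_dy_fdx, H. Qed.
Lemma diff1_fdy eps g : diff1 g -> diff1 (fdy eps g).
Proof. intros H x y; eexists; apply is_dx_fdy, H. Qed.
Lemma diff2_fdy eps g : diff2 g -> diff2 (fdy eps g).
Proof. intros H x y; eexists; apply is_dy_fdy, H. Qed.

Lemma diff1_minus f g : diff1 f -> diff1 g -> diff1 (fun x y => f x y - g x y).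
Proof. intros F G x y; eexists; apply (is_derive_minus (fun t => f t y) (fun t => g t y)); apply is_dx; auto. Qed.
Lemma diff2_minus f g : diff2 f -> diff2 g -> diff2 (fun x y => f x y - g x y).
Proof. intros F G x y; eexists; apply (is_derive_minus (fun t => f x t) (fun t => g x t)); apply is_dy; auto. Qed.

(* The analogue of [bnd] for families of functions on the plane, with genuine partial
   derivatives and bounds on every compact set. *)
Fixpoint ubd (N k : nat) (h : R -> R -> R -> R) : Prop :=
  (forall A, exists c, forall eps x y, 0 < eps < 1 -> Rabs x <= A -> Rabs y <= A ->
     Rabs (h eps x y) <= c * eps ^ k) /\
  match N with
  | 0%nat => True
  | S N => (forall eps, diff1 (h eps) /\ diff2 (h eps)) /\
           ubd N k (fun eps => dx (h eps)) /\ ubd N k (fun eps => dy (h eps))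
  end.

Lemma ubd_0 N k h : ubd N k h -> forall A, exists c, forall eps x y,
  0 < eps < 1 -> Rabs x <= A -> Rabs y <= A -> Rabs (h eps x y) <= c * eps ^ k.
Proof. destruct N; intros H; apply H. Qed.

Lemma ubd_smooth N : forall g, smooth_R2 g -> ubd N 0 (fun _ => g).
Proof.
  induction N as [|N IH]; intros g H;
    (split; [intros A; destruct (C0_bounded g (- A) A (smooth_C0 _ H)) as (M & _ & B);
       exists M; intros eps x y _ Hx Hy; simpl; rewrite Rmult_1_r;
       apply B; apply Rabs_le_between; auto|]).
  - trivial.
  - split; [intros _; split; [apply smooth_diff1 | apply smooth_diff2]; auto|].
    split; apply IH; [apply smooth_dx | apply smooth_dy]; auto.
Qed.

Lemma abs_shift A x eps s : 0 < eps < 1 -> Rabs x <= A -> x <= s <= x + eps -> Rabs s <= A + 1.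
Proof. intros He Hx Hs; apply Rabs_le_between in Hx; apply Rabs_le_between; lra. Qed.

(** A quotient is bounded by the derivative on [[x, x + eps]]; this costs one order and enlarges the
    compact set by 1, as [eps < 1]. Quotients commute with partial derivatives, which carries the
    induction. *)
Lemma ubd_fdx N k : forall h, ubd (S N) k h -> ubd N k (fun eps => fdx eps (h eps)).
Proof.
  induction N as [|N IH]; intros h H; pose proof H as (_ & HD & HX & HY);
    (split; [intros A; destruct (ubd_0 _ _ _ HX (A + 1)) as [c B]; exists c;
       intros eps x y He Hx Hy;
       apply (mvt_quotient (fun t => h eps t y) (fun t => dx (h eps) t y));
       [lra | intros s; apply is_dx, HD | intros s Hs; apply B; auto;
          [apply (abs_shift A x eps); auto | lra]]|]).
  - trivial.
  - split; [|split].
    + intros eps; split; [apply diff1_fdx | apply diff2_fdx]; apply HD.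
    + replace (fun eps => dx (fdx eps (h eps))) with (fun eps => fdx eps (dx (h eps))).
      * apply (IH (fun eps => dx (h eps))), HX.
      * apply functional_extensionality; intros eps; symmetry; apply dx_fdx, HD.
    + replace (fun eps => dy (fdx eps (h eps))) with (fun eps => fdx eps (dy (h eps))).
      * apply (IH (fun eps => dy (h eps))), HY.
      * apply functional_extensionality; intros eps; symmetry; apply dy_fdx, HD.
Qed.

Lemma ubd_fdy N k : forall h, ubd (S N) k h -> ubd N k (fun eps => fdy eps (h eps)).
Proof.
  induction N as [|N IH]; intros h H; pose proof H as (_ & HD & HX & HY);
    (split; [intros A; destruct (ubd_0 _ _ _ HY (A + 1)) as [c B]; exists c;
       intros eps x y He Hx Hy;
       apply (mvt_quotient (fun t => h eps x t) (fun t => dy (h eps) x t));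
       [lra | intros s; apply is_dy, HD | intros s Hs; apply B; auto;
          [lra | apply (abs_shift A y eps); auto]]|]).
  - trivial.
  - split; [|split].
    + intros eps; split; [apply diff1_fdy | apply diff2_fdy]; apply HD.
    + replace (fun eps => dx (fdy eps (h eps))) with (fun eps => fdy eps (dx (h eps))).
      * apply (IH (fun eps => dx (h eps))), HX.
      * apply functional_extensionality; intros eps; symmetry; apply dx_fdy, HD.
    + replace (fun eps => dy (fdy eps (h eps))) with (fun eps => fdy eps (dy (h eps))).
      * apply (IH (fun eps => dy (h eps))), HY.
      * apply functional_extensionality; intros eps; symmetry; apply dy_fdy, HD.
Qed.

(** The mean value bound is applied to [h s - h' x * s], whose derivative [h' s - h' x] is at most
    [M eps] on the interval. *)
Lemma taylor_quotient (h h' h'' : R -> R) x eps M : 0 < eps ->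
  (forall s, is_derive h s (h' s)) -> (forall s, is_derive h' s (h'' s)) ->
  (forall s, x <= s <= x + eps -> Rabs (h'' s) <= M) ->
  Rabs (/ eps * (h (x + eps) - h x) - h' x) <= M * eps.
Proof.
  intros He H1 H2 B.
  replace (/ eps * (h (x + eps) - h x) - h' x) with
    (/ eps * ((h (x + eps) - h' x * (x + eps)) - (h x - h' x * x))) by (field; lra).
  apply (mvt_quotient (fun s => h s - h' x * s) (fun s => h' s - h' x)); auto.
  - intros s; apply (is_derive_minus h (fun s => h' x * s)); auto.
    pose proof (is_derive_scal (fun s : R => s) s (h' x) 1 (is_derive_id s)) as L.
    rewrite Rmult_1_r in L; exact L.
  - intros s Hs.
    assert (HM : 0 <= M) by (eapply Rle_trans; [apply Rabs_pos | apply (B x); lra]).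
    apply Rle_trans with (M * Rabs (s - x)).
    + apply (mvt_bound h' h''); auto.
      * intros t _; apply (ex_derive_continuous h'); exists (h'' t); apply H2.
      * rewrite Rmin_left, Rmax_right by lra; intros t Ht; apply B; lra.
    + apply Rmult_le_compat_l; auto; rewrite Rabs_pos_eq; lra.
Qed.

(** Both partial derivatives of the error for [g] are again such errors, for [dx g] and [dy g]; the
    latter by symmetry of the mixed derivatives. *)
Lemma ubd_fdx_error N : forall g, smooth_R2 g ->
  ubd N 1 (fun eps x y => fdx eps g x y - dx g x y).
Proof.
  induction N as [|N IH]; intros g H;
    (split; [intros A; destruct (C0_bounded (dx (dx g)) (- (A + 1)) (A + 1)
        (smooth_C0 _ (smooth_dx _ (smooth_dx _ H)))) as (M & _ & B); exists M;
      intros eps x y He Hx Hy; rewrite pow_1;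
      apply (taylor_quotient (fun t => g t y) (fun t => dx g t y) (fun t => dx (dx g) t y));
      [lra | intros s; apply is_dx, smooth_diff1, H
      | intros s; apply (is_dx (dx g)), smooth_diff1, smooth_dx, H
      | intros s Hs; apply B; apply Rabs_le_between; [apply (abs_shift A x eps); auto | lra]]|]).
  - trivial.
  - pose proof (smooth_diff1 _ H) as D1; pose proof (smooth_diff2 _ H) as D2.
    pose proof (smooth_diff1 _ (smooth_dx _ H)) as D3.
    pose proof (smooth_diff2 _ (smooth_dx _ H)) as D4.
    split; [|split].
    + intros eps; split; [apply diff1_minus | apply diff2_minus];
        auto using diff1_fdx, diff2_fdx.
    + replace (fun eps => dx (fun x y => fdx eps g x y - dx g x y)) with
        (fun eps x y => fdx eps (dx g) x y - dx (dx g) x y); [apply IH, smooth_dx, H|].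
      apply functional_extensionality; intros eps; symmetry; apply (d_ext dx); intros x y.
      rewrite (dx_minus (fdx eps g)), dx_fdx; auto using diff1_fdx.
    + replace (fun eps => dy (fun x y => fdx eps g x y - dx g x y)) with
        (fun eps x y => fdx eps (dy g) x y - dx (dy g) x y); [apply IH, smooth_dy, H|].
      apply functional_extensionality; intros eps; symmetry; apply (d_ext dy); intros x y.
      rewrite (dy_minus (fdx eps g)), dy_fdx, smooth_schwarz; auto using diff2_fdx.
Qed.

Lemma ubd_fdy_error N : forall g, smooth_R2 g ->
  ubd N 1 (fun eps x y => fdy eps g x y - dy g x y).
Proof.
  induction N as [|N IH]; intros g H;
    (split; [intros A; destruct (C0_bounded (dy (dy g)) (- (A + 1)) (A + 1)
        (smooth_C0 _ (smooth_dy _ (smooth_dy _ H)))) as (M & _ & B); exists M;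
      intros eps x y He Hx Hy; rewrite pow_1;
      apply (taylor_quotient (fun t => g x t) (fun t => dy g x t) (fun t => dy (dy g) x t));
      [lra | intros s; apply is_dy, smooth_diff2, H
      | intros s; apply (is_dy (dy g)), smooth_diff2, smooth_dy, H
      | intros s Hs; apply B; apply Rabs_le_between; [lra | apply (abs_shift A y eps); auto]]|]).
  - trivial.
  - pose proof (smooth_diff1 _ H) as D1; pose proof (smooth_diff2 _ H) as D2.
    pose proof (smooth_diff1 _ (smooth_dy _ H)) as D3.
    pose proof (smooth_diff2 _ (smooth_dy _ H)) as D4.
    split; [|split].
    + intros eps; split; [apply diff1_minus | apply diff2_minus];
        auto using diff1_fdy, diff2_fdy.
    + replace (fun eps => dx (fun x y => fdy eps g x y - dy g x y)) with
        (fun eps x y => fdy eps (dx g) x y - dy (dx g) x y); [apply IH, smooth_dx, H|].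
      apply functional_extensionality; intros eps; symmetry; apply (d_ext dx); intros x y.
      rewrite (dx_minus (fdy eps g)), dx_fdy, smooth_schwarz; auto using diff1_fdy.
    + replace (fun eps => dy (fun x y => fdy eps g x y - dy g x y)) with
        (fun eps x y => fdy eps (dy g) x y - dy (dy g) x y); [apply IH, smooth_dy, H|].
      apply functional_extensionality; intros eps; symmetry; apply (d_ext dy); intros x y.
      rewrite (dy_minus (fdy eps g)), dy_fdy; auto using diff2_fdy.
Qed.

Definition smpf (h : R -> R -> R -> R) : gridfam :=
  fun eps i j => h eps (eps * INR i) (eps * INR j).

Section Convergence.

Variable r : R.

(** Lattice quotients of samples are samples of the quotients [fdx] and [fdy], so bounds on the
    compact square of half-width [r] carry over. *)
Lemma bnd_smpf N : forall k p q h, ubd N k h -> bnd r N k p q (smpf h).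
Proof.
  induction N as [|N IH]; intros k p q h H;
    (split; [destruct (ubd_0 _ _ _ H r) as [c B]; exists c, 1; split; [lra|];
      intros eps i j Hs (Hp & Hi & Hj);
      assert (Q : forall a b, eps * INR (a + b) <= r -> Rabs (eps * INR a) <= r) by
        (intros a b Hab; rewrite plus_INR in Hab;
         pose proof (Rmult_le_pos _ _ (Rlt_le _ _ Hp) (pos_INR a));
         pose proof (Rmult_le_pos _ _ (Rlt_le _ _ Hp) (pos_INR b));
         rewrite Rabs_pos_eq by auto; lra);
      apply B; [lra | apply (Q i p Hi) | apply (Q j q Hj)]|]).
  - trivial.
  - split.
    + replace (FD1 (smpf h)) with (smpf (fun eps => fdx eps (h eps))).
      * apply IH, ubd_fdx, H.
      * apply gridfam_ext; intros eps i j; unfold FD1, smpf, fdx.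
        rewrite S_INR, Rmult_plus_distr_l, Rmult_1_r; reflexivity.
    + replace (FD2 (smpf h)) with (smpf (fun eps => fdy eps (h eps))).
      * apply IH, ubd_fdy, H.
      * apply gridfam_ext; intros eps i j; unfold FD2, smpf, fdy.
        rewrite S_INR, Rmult_plus_distr_l, Rmult_1_r; reflexivity.
Qed.

Lemma bnd_smooth N p q g : smooth_R2 g -> bnd r N 0 p q (smp g).
Proof. intros H; apply (bnd_smpf N 0 p q (fun _ => g)), ubd_smooth, H. Qed.

Lemma bnd_FD1_error N p q g : smooth_R2 g ->
  bnd r N 1 p q (fun eps i j => FD1 (smp g) eps i j - smp (dx g) eps i j).
Proof.
  intros H; eapply bnd_ext; [|apply (bnd_smpf N 1 p q _ (ubd_fdx_error N g H))].
  intros eps i j _; unfold smpf, FD1, smp, fdx.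
  rewrite S_INR, Rmult_plus_distr_l, Rmult_1_r; reflexivity.
Qed.

Lemma bnd_FD2_error N p q g : smooth_R2 g ->
  bnd r N 1 p q (fun eps i j => FD2 (smp g) eps i j - smp (dy g) eps i j).
Proof.
  intros H; eapply bnd_ext; [|apply (bnd_smpf N 1 p q _ (ubd_fdy_error N g H))].
  intros eps i j _; unfold smpf, FD2, smp, fdy.
  rewrite S_INR, Rmult_plus_distr_l, Rmult_1_r; reflexivity.
Qed.

(** Subtracting [tau_1 n + tau_2 n] from both sides of the discrete Moutard equation and dividing by
    [eps^2] gives [delta_1 delta_2 n = q/2 (tau_1 n + tau_2 n)]. This is the defect of the sampled
    smooth solution in that form. *)
Definition moutard_residual (q u : R -> R -> R) : gridfam :=
  fun eps i j => FD1 (FD2 (smp u)) eps i j -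
    / 2 * smp q eps i j * (sh1 (smp u) eps i j + sh2 (smp u) eps i j).

(** Three errors add up: [FD1] of the consistency error of [FD2 u], the consistency error of [FD1]
    on [dy u], and the replacement of [2 u] by the two shifted values, which costs
    [eps (FD1 u + FD2 u)]. *)
Lemma bnd_residual N (q u : R -> R -> R) : smooth_R2 q -> smooth_R2 u ->
  (forall x y, dx (dy u) x y = q x y * u x y) ->
  bnd r N 1 1 1 (moutard_residual q u).
Proof.
  intros Hq Hu E.
  pose proof (bnd_FD2_error (S N) 0 1 u Hu) as (_ & A & _).
  pose proof (bnd_FD1_error N 1 1 (dy u) (smooth_dy _ Hu)) as B.
  pose proof (bnd_smooth (S N) 0 1 u Hu) as (_ & C1 & _).
  pose proof (bnd_smooth (S N) 1 0 u Hu) as (_ & _ & C2).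
  apply bnd_eps in C1; apply bnd_eps in C2.
  pose proof (bnd_mult _ _ _ _ _ _ _ _ (bnd_scal _ _ _ _ _ (/ 2) _ (bnd_smooth N 1 1 q Hq))
    (bnd_plus _ _ _ _ _ _ _ C1 C2)) as D.
  eapply bnd_ext; [|apply (bnd_minus _ _ _ _ _ _ _ (bnd_plus _ _ _ _ _ _ _ A B) D)].
  intros eps i j (Hp & _); unfold moutard_residual, sh1, sh2.
  assert (E' : smp (dx (dy u)) eps i j = smp q eps i j * smp u eps i j) by apply E.
  rewrite E'; unfold FD1, FD2; field; lra.
Qed.

(** Induction over the columns: each one adds at most [eps B] to the bound. Smallness of [r] lets
    this close with a linear instead of an exponential growth. *)
Lemma discrete_goursat_bound (e Q Rs : nat -> nat -> R) eps K B :
  0 < eps -> 0 <= K -> 0 <= B -> r <= / 4 -> K * r <= 1 ->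
  (forall i j, eps * INR (S i) <= r -> eps * INR (S j) <= r ->
    e (S i) (S j) - e (S i) j - e i (S j) + e i j =
    eps ^ 2 * (/ 2 * Q i j * (e (S i) j + e i (S j)) - Rs i j) /\
    Rabs (Q i j) <= K /\ Rabs (Rs i j) <= B) ->
  (forall i, eps * INR i <= r -> e i 0%nat = 0) ->
  (forall j, eps * INR j <= r -> e 0%nat j = 0) ->
  forall i j, eps * INR i <= r -> eps * INR j <= r -> Rabs (e i j) <= eps * INR i * B.
Proof.
  intros He HK HB Hr HKr H E1 E2; induction i as [|i IH]; intros j Hi Hj.
  - rewrite E2, Rabs_R0 by auto; simpl; lra.
  - rewrite S_INR in Hi.
    pose proof (pos_INR i) as Pi.
    assert (Hi' : eps * INR i <= r) by nra.
    assert (Her : eps <= r) by nra.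
    set (m := eps * INR i * B).
    assert (Hm : 0 <= m <= r * B).
    { unfold m; split; [apply Rmult_le_pos; auto; nra | apply Rmult_le_compat_r; auto]. }
    (* [X] bounds the right-hand side up to the unknown increment: the values of the previous column
       contribute at most [K m], the residual [B]. *)
    set (X := K * m + B).
    assert (HX : 0 <= X <= 2 * B).
    { unfold X; split; [nra|].
      assert (K * m <= K * (r * B)) by (apply Rmult_le_compat_l; lra).
      assert (K * r * B <= 1 * B) by (apply Rmult_le_compat_r; lra). lra. }
    (* The increment between the two columns grows by at most [2 eps^2 X] per step in [j]; the
       factor 2 leaves room for the increment itself, which also occurs on the right-hand side. *)
    assert (D : Rabs (e (S i) j - e i j) <= 2 * INR j * eps ^ 2 * X).
    { revert Hj; induction j as [|j IHj]; intros Hj.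
      - rewrite !E1; [rewrite Rminus_diag, Rabs_R0; simpl; lra | auto | rewrite S_INR; auto].
      - rewrite S_INR in Hj.
        pose proof (pos_INR j) as Pj.
        assert (Hj' : eps * INR j <= r) by nra.
        specialize (IHj Hj').
        destruct (H i j) as (Eq & HQ & HR); [rewrite S_INR; auto | rewrite S_INR; auto |].
        pose proof (IH j Hi' Hj') as M1; fold m in M1.
        pose proof (IH (S j) Hi' ltac:(rewrite S_INR; auto)) as M2; fold m in M2.
        set (d := e (S i) j - e i j) in *.
        replace (e (S i) (S j) - e i (S j)) with
          (d + eps ^ 2 * (/ 2 * Q i j * (e i j + d + e i (S j)) - Rs i j))
          by (replace (e i j + d) with (e (S i) j) by (unfold d; ring);
              rewrite <- Eq; unfold d; ring).
        eapply Rle_trans; [apply Rabs_triang|].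
        rewrite Rabs_mult, (Rabs_pos_eq (eps ^ 2)) by (apply pow_le; lra).
        assert (T : Rabs (/ 2 * Q i j * (e i j + d + e i (S j)) - Rs i j) <= 2 * X).
        { assert (S1 : Rabs (e i j + d + e i (S j)) <= 2 * m + Rabs d).
          { eapply Rle_trans; [apply Rabs_triang|].
            pose proof (Rabs_triang (e i j) d); lra. }
          assert (S2 : Rabs d <= 2 * r * eps * X).
          { apply Rle_trans with (1 := IHj).
            replace (2 * INR j * eps ^ 2 * X) with (2 * (eps * INR j) * (eps * X)) by ring.
            replace (2 * r * eps * X) with (2 * r * (eps * X)) by ring.
            apply Rmult_le_compat_r; [apply Rmult_le_pos; lra | lra]. }
          assert (S3 : K * Rabs d <= 2 * X).
          { apply Rle_trans with (K * (2 * r * eps * X)); [apply Rmult_le_compat_l; auto|].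
            replace (K * (2 * r * eps * X)) with (K * r * (2 * (eps * X))) by ring.
            assert (0 <= eps * X <= 1 * X).
            { split; [apply Rmult_le_pos | apply Rmult_le_compat_r]; lra. }
            apply Rle_trans with (1 * (2 * (eps * X))); [apply Rmult_le_compat_r; lra | lra]. }
          unfold Rminus; eapply Rle_trans; [apply Rabs_triang|].
          rewrite Rabs_Ropp, !Rabs_mult, (Rabs_pos_eq (/ 2)) by lra.
          assert (S4 : Rabs (Q i j) * Rabs (e i j + d + e i (S j)) <= K * (2 * m + Rabs d)).
          { apply Rmult_le_compat; auto using Rabs_pos. }
          unfold X in *; lra. }
        assert (S5 : eps ^ 2 * Rabs (/ 2 * Q i j * (e i j + d + e i (S j)) - Rs i j) <= eps ^ 2 * (2 * X)).
        { apply Rmult_le_compat_l; [apply pow_le; lra | auto]. }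
        rewrite S_INR; lra. }
    rewrite S_INR.
    replace (e (S i) j) with ((e (S i) j - e i j) + e i j) by ring.
    eapply Rle_trans; [apply Rabs_triang|].
    specialize (IH j Hi' Hj); fold m in IH.
    (* By [eps j <= r <= 1/4] and [X <= 2 B], the latter being a consequence of [K r <= 1]. *)
    assert (F : 2 * INR j * eps ^ 2 * X <= eps * B).
    { replace (2 * INR j * eps ^ 2 * X) with (eps * (2 * (eps * INR j) * X)) by ring.
      apply Rmult_le_compat_l; [lra|].
      apply Rle_trans with (2 * / 4 * (2 * B)); [|lra].
      pose proof (pos_INR j) as Pj.
      apply Rmult_le_compat; try lra.
      apply Rmult_le_pos; [lra | apply Rmult_le_pos; lra]. }
    unfold m in IH; lra.
Qed.

Lemma moutard_convergence (q u : R -> R -> R) K (U : gridfam) :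
  smooth_R2 q -> smooth_R2 u -> (forall x y, dx (dy u) x y = q x y * u x y) ->
  0 <= K -> r <= / 4 -> K * r <= 1 ->
  (forall x y, in_square r x y -> Rabs (q x y) <= K) ->
  (forall eps i j, dom r 1 1 eps i j ->
     U eps (S i) (S j) + U eps i j =
     (1 + / 2 * eps ^ 2 * smp q eps i j) * (U eps (S i) j + U eps i (S j))) ->
  (forall eps i, dom r 0 0 eps i 0 -> U eps i 0%nat = smp u eps i 0%nat) ->
  (forall eps j, dom r 0 0 eps 0 j -> U eps 0%nat j = smp u eps 0%nat j) ->
  forall N, bnd r N 1 0 0 (fun eps i j => U eps i j - smp u eps i j).
Proof.
  intros Hq Hu E HK Hr HKr Q EU U1 U2.
  set (e := fun eps i j => U eps i j - smp u eps i j).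
  assert (Ee : forall eps i j, dom r 1 1 eps i j -> FD1 (FD2 e) eps i j =
     / 2 * smp q eps i j * (sh1 e eps i j + sh2 e eps i j) - moutard_residual q u eps i j).
  { intros eps i j D; pose proof D as (Hp & _); specialize (EU eps i j D).
    assert (EU' : U eps (S i) (S j) =
      (1 + / 2 * eps ^ 2 * smp q eps i j) * (U eps (S i) j + U eps i (S j)) - U eps i j) by lra.
    unfold moutard_residual, e, FD1, FD2, sh1, sh2; rewrite EU'; field; lra. }
  intros N; induction N as [|N IH].
  - split; [|trivial].
    destruct (bnd_sup _ _ _ _ _ _ (bnd_residual 0 q u Hq Hu E)) as (c & e0 & He0 & B).
    exists (Rabs c), (Rmin 1 e0); split; [apply Rmin_pos; lra|].
    intros eps i j Hs (Hp & Hi & Hj).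
    pose proof (Rmin_l 1 e0); pose proof (Rmin_r 1 e0).
    rewrite Nat.add_0_r in Hi, Hj.
    assert (P : 0 <= Rabs c * eps ^ 1) by (apply Rmult_le_pos; [apply Rabs_pos | lra]).
    assert (Hr0 : 0 <= r) by (pose proof (pos_INR i); nra).
    apply Rle_trans with (eps * INR i * (Rabs c * eps ^ 1)).
    + apply (discrete_goursat_bound (e eps) (smp q eps) (moutard_residual q u eps) eps K); auto.
      * intros i' j' Hi' Hj'.
        assert (D : dom r 1 1 eps i' j') by (unfold dom; rewrite !Nat.add_1_r; auto).
        assert (X : forall n, eps * INR (S n) <= r -> 0 <= eps * INR n <= r).
        { intros n Hn; rewrite S_INR in Hn; pose proof (pos_INR n); nra. }
        split; [|split].
        -- specialize (Ee eps i' j' D); unfold FD1, FD2, sh1, sh2 in Ee.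
           rewrite <- Ee; field; lra.
        -- apply Q; split; apply X; auto.
        -- eapply Rle_trans; [apply B; auto; lra|].
           apply Rmult_le_compat_r; [lra | apply Rle_abs].
      * intros i' Hi'; unfold e; rewrite U1; [ring|].
        unfold dom; rewrite !Nat.add_0_r; repeat split; auto; simpl; lra.
      * intros j' Hj'; unfold e; rewrite U2; [ring|].
        unfold dom; rewrite !Nat.add_0_r; repeat split; auto; simpl; lra.
    + rewrite <- (Rmult_1_l (Rabs c * eps ^ 1)) at 2; apply Rmult_le_compat_r; auto; lra.
  (* The equation contains only shifts of [e] on the right, so it yields the mixed quotient to the
     same order [N]. Since [e] vanishes on the axes, [FD1 e] starts from zero at [j = 0] and [FD2 e]
     at [i = 0], and both can be summed. *)
  - assert (G : bnd r N 1 1 1 (FD1 (FD2 e))).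
    { eapply bnd_ext; [intros; symmetry; apply Ee; assumption|].
      apply bnd_minus; [|apply bnd_residual; auto].
      apply (bnd_mult r N 0 1).
      - apply bnd_scal, bnd_smooth, Hq.
      - apply bnd_plus.
        + apply (bnd_weaken r N 1 1 0); [lia | lia | apply bnd_sh1, IH].
        + apply (bnd_weaken r N 1 0 1); [lia | lia | apply bnd_sh2, IH]. }
    split; [apply (bnd_sup _ _ _ _ _ _ IH)|].
    split.
    + apply bnd_sum2; [|rewrite <- FD12; exact G].
      intros eps i D; unfold FD1, e; rewrite !U1; [ring| |];
        apply (dom_le _ _ _ _ _ _ _ _ _ _ D); lia.
    + apply bnd_sum1; [|exact G].
      intros eps j D; unfold FD2, e; rewrite !U2; [ring| |];
        apply (dom_le _ _ _ _ _ _ _ _ _ _ D); lia.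
Qed.

(** The right-hand sides of the Lelieuvre formulas are bilinear in the normal and its quotients and
    inherit their [O(eps)] error to every order. This covers all quotients of the surface error; the
    error itself is summed from its zero value at the origin. *)
Lemma potential_convergence (u v F : R -> R -> R) (U V G : gridfam) :
  smooth_R2 u -> smooth_R2 v -> smooth_R2 F ->
  dx F = (fun x y => dx u x y * v x y - dx v x y * u x y) ->
  dy F = (fun x y => u x y * dy v x y - v x y * dy u x y) ->
  (forall N, bnd r N 1 0 0 (fun eps i j => U eps i j - smp u eps i j)) ->
  (forall N, bnd r N 1 0 0 (fun eps i j => V eps i j - smp v eps i j)) ->
  (forall eps i j, dom r 1 0 eps i j -> FD1 G eps i j =
     FD1 U eps i j * V eps i j - FD1 V eps i j * U eps i j) ->
  (forall eps i j, dom r 0 1 eps i j -> FD2 G eps i j =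
     U eps i j * FD2 V eps i j - V eps i j * FD2 U eps i j) ->
  (forall eps, 0 < eps -> G eps 0%nat 0%nat = F 0 0) ->
  forall N, bnd r N 1 0 0 (fun eps i j => G eps i j - smp F eps i j).
Proof.
  intros Hu Hv HF EX EY BU BV G1 G2 G0.
  set (g := fun eps i j => G eps i j - smp F eps i j).
  (* The quotient of the discrete function approaches the derivative of the smooth one by
     convergence, applied to the quotient of the difference, and by consistency. *)
  assert (X : forall N (w : R -> R -> R) W, smooth_R2 w ->
    bnd r (S N) 1 0 0 (fun eps i j => W eps i j - smp w eps i j) ->
    bnd r N 1 1 0 (fun eps i j => FD1 W eps i j - smp (dx w) eps i j) /\
    bnd r N 1 0 1 (fun eps i j => FD2 W eps i j - smp (dy w) eps i j)).
  { intros N w W Hw (_ & A1 & A2); split.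
    - eapply bnd_ext; [|apply (bnd_plus _ _ _ _ _ _ _ A1 (bnd_FD1_error N 1 0 w Hw))].
      intros; unfold FD1; ring.
    - eapply bnd_ext; [|apply (bnd_plus _ _ _ _ _ _ _ A2 (bnd_FD2_error N 0 1 w Hw))].
      intros; unfold FD2; ring. }
  assert (B1 : forall N, bnd r N 1 1 0 (FD1 g)).
  { intros N.
    destruct (X N u U Hu (BU _)) as [XU _], (X N v V Hv (BV _)) as [XV _].
    assert (W1 : forall w W, bnd r N 1 0 0 (fun eps i j => W eps i j - smp w eps i j) ->
      bnd r N 1 1 0 (fun eps i j => W eps i j - smp w eps i j)).
    { intros w W; apply bnd_weaken; lia. }
    pose proof (bnd_product_error r N 1 0 _ _ _ _ XU (W1 _ _ (BV N))
      (bnd_smooth _ _ _ _ (smooth_dx _ Hu)) (bnd_smooth _ _ _ _ Hv)) as Y1.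
    pose proof (bnd_product_error r N 1 0 _ _ _ _ XV (W1 _ _ (BU N))
      (bnd_smooth _ _ _ _ (smooth_dx _ Hv)) (bnd_smooth _ _ _ _ Hu)) as Y2.
    eapply bnd_ext; [|apply (bnd_minus _ _ _ _ _ _ _ (bnd_minus _ _ _ _ _ _ _ Y1 Y2)
      (bnd_FD1_error N 1 0 F HF))].
    intros eps i j D; specialize (G1 eps i j D).
    assert (E : smp (dx F) eps i j = smp (dx u) eps i j * smp v eps i j -
      smp (dx v) eps i j * smp u eps i j) by (rewrite EX; reflexivity).
    replace (FD1 g eps i j) with (FD1 G eps i j - FD1 (smp F) eps i j)
      by (unfold FD1, g; ring).
    rewrite G1, E; ring. }
  assert (B2 : forall N, bnd r N 1 0 1 (FD2 g)).
  { intros N.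
    destruct (X N u U Hu (BU _)) as [_ XU], (X N v V Hv (BV _)) as [_ XV].
    assert (W1 : forall w W, bnd r N 1 0 0 (fun eps i j => W eps i j - smp w eps i j) ->
      bnd r N 1 0 1 (fun eps i j => W eps i j - smp w eps i j)).
    { intros w W; apply bnd_weaken; lia. }
    pose proof (bnd_product_error r N 0 1 _ _ _ _ XU (W1 _ _ (BV N))
      (bnd_smooth _ _ _ _ (smooth_dy _ Hu)) (bnd_smooth _ _ _ _ Hv)) as Y1.
    pose proof (bnd_product_error r N 0 1 _ _ _ _ XV (W1 _ _ (BU N))
      (bnd_smooth _ _ _ _ (smooth_dy _ Hv)) (bnd_smooth _ _ _ _ Hu)) as Y2.
    eapply bnd_ext; [|apply (bnd_minus _ _ _ _ _ _ _ (bnd_minus _ _ _ _ _ _ _ Y2 Y1)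
      (bnd_FD2_error N 0 1 F HF))].
    intros eps i j D; specialize (G2 eps i j D).
    assert (E : smp (dy F) eps i j = smp u eps i j * smp (dy v) eps i j -
      smp v eps i j * smp (dy u) eps i j) by (rewrite EY; reflexivity).
    replace (FD2 g eps i j) with (FD2 G eps i j - FD2 (smp F) eps i j)
      by (unfold FD2, g; ring).
    rewrite G2, E; ring. }
  assert (B0 : sup r 1 0 0 g).
  { apply sup_from_origin.
    - intros eps Hp; unfold g, smp; simpl; rewrite !Rmult_0_r, G0 by auto; ring.
    - apply (bnd_sup _ _ _ _ _ _ (B1 0%nat)).
    - apply (bnd_sup _ _ _ _ _ _ (B2 0%nat)). }
  intros [|N]; split; auto.
Qed.

End Convergence.

(** * Vector fields and discrete surfaces *)

Lemma vec_ext (u v : vec3) : crd1 u = crd1 v -> crd2 u = crd2 v -> crd3 u = crd3 v -> u = v.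
Proof.
  destruct u as [[a b] c], v as [[a' b'] c']; unfold crd1, crd2, crd3; simpl.
  intros; subst; reflexivity.
Qed.

Lemma norm_vec_le (v : vec3) : norm v <= Rabs (crd1 v) + Rabs (crd2 v) + Rabs (crd3 v).
Proof.
  assert (P : forall a b : R, 0 <= a -> 0 <= b -> sqrt (a ^ 2 + b ^ 2) <= a + b).
  { intros a b Ha Hb; rewrite <- (sqrt_pow2 (a + b)) by lra.
    apply sqrt_le_1_alt; nra. }
  destruct v as [[a b] c].
  change (norm (V := vec3) ((a, b), c)) with
    (sqrt (sqrt (Rabs a ^ 2 + Rabs b ^ 2) ^ 2 + Rabs c ^ 2)).
  eapply Rle_trans; [apply P; [apply sqrt_pos | apply Rabs_pos]|].
  apply Rplus_le_compat_r, P; apply Rabs_pos.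
Qed.

Lemma in_span_of_orthogonal (w u v : vec3) : cross u v <> zero ->
  crd1 w * crd1 (cross u v) + crd2 w * crd2 (cross u v) + crd3 w * crd3 (cross u v) = 0 ->
  in_span w u v.
Proof.
  intros H0 H.
  set (X := cross u v) in *.
  set (d := crd1 X ^ 2 + crd2 X ^ 2 + crd3 X ^ 2).
  assert (Hd : d <> 0).
  { intros E; apply H0.
    pose proof (pow2_ge_0 (crd1 X)); pose proof (pow2_ge_0 (crd2 X));
      pose proof (pow2_ge_0 (crd3 X)); unfold d in E.
    apply vec_ext; [change (crd1 X = 0) | change (crd2 X = 0) | change (crd3 X = 0)];
      apply Rsqr_0_uniq; rewrite Rsqr_pow2; lra. }
  set (dot := fun a b : vec3 => crd1 a * crd1 b + crd2 a * crd2 b + crd3 a * crd3 b).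
  exists (dot (cross w v) X / d), (dot (cross u w) X / d).
  assert (S : forall x a b : R, d * x = a * dot (cross w v) X + b * dot (cross u w) X ->
    x = dot (cross w v) X / d * a + dot (cross u w) X / d * b).
  { intros x a b E; apply (Rmult_eq_reg_l d); [rewrite E; field | ]; exact Hd. }
  (* [|X|^2 w = ((w x v).X) u + ((u x w).X) v + (w.X) X] for [X = u x v] *)
  apply vec_ext; [apply (S (crd1 w) (crd1 u) (crd1 v))
                 | apply (S (crd2 w) (crd2 u) (crd2 v))
                 | apply (S (crd3 w) (crd3 u) (crd3 v))];
    apply Rminus_diag_uniq;
    [ replace 0 with ((crd1 w * crd1 X + crd2 w * crd2 X + crd3 w * crd3 X) * crd1 X) by (rewrite H; ring)
    | replace 0 with ((crd1 w * crd1 X + crd2 w * crd2 X + crd3 w * crd3 X) * crd2 X) by (rewrite H; ring)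
    | replace 0 with ((crd1 w * crd1 X + crd2 w * crd2 X + crd3 w * crd3 X) * crd3 X) by (rewrite H; ring)];
    clear; destruct w as [[w1 w2] w3], u as [[u1 u2] u3], v as [[v1 v2] v3];
    unfold d, dot, X, cross, mkvec, crd1, crd2, crd3; simpl; ring.
Qed.

(** Both tangent vectors [cross a n] and [cross n b] are orthogonal to [n], so their cross product
    is a multiple of [n], to which [cross p n] is orthogonal. *)
Lemma in_span_asymptotic (n a b p : vec3) :
  cross (cross a n) (cross n b) <> zero ->
  in_span (cross p n) (cross a n) (cross n b) /\ in_span (cross n p) (cross a n) (cross n b).
Proof.
  intros H; split; apply in_span_of_orthogonal; auto; clear;
    destruct n as [[n1 n2] n3], a as [[a1 a2] a3], b as [[b1 b2] b3], p as [[p1 p2] p3];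
    unfold cross, mkvec, crd1, crd2, crd3; simpl; ring.
Qed.

(** * Explicit discrete normals and surfaces *)

Fixpoint moutard_row (A prev : nat -> R) (s : R) (j : nat) : R :=
  match j with
  | 0%nat => s
  | S j => A j * (moutard_row A prev s j + prev (S j)) - prev j
  end.

(** Solved for the vertex opposite to the origin, the discrete Moutard equation is a recursion
    without division, which runs for any coefficient over the whole quadrant. *)
Fixpoint moutard_grid (A : nat -> nat -> R) (a b : nat -> R) (i : nat) : nat -> R :=
  match i with
  | 0%nat => b
  | S i => moutard_row (A i) (moutard_grid A a b i) (a (S i))
  end.

Lemma moutard_grid_eq A a b i j :
  moutard_grid A a b (S i) (S j) + moutard_grid A a b i j =
  A i j * (moutard_grid A a b (S i) j + moutard_grid A a b i (S j)).
Proof. simpl; ring. Qed.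

Lemma moutard_grid_axis A a b i : a 0%nat = b 0%nat -> moutard_grid A a b i 0%nat = a i.
Proof. intros H; destruct i; simpl; auto. Qed.

Fixpoint partial_sum (w : nat -> R) (n : nat) : R :=
  match n with 0%nat => 0 | S n => partial_sum w n + w n end.

(** The summands are [eps] times the Lelieuvre expressions: in [(U' - U) V - (V' - V) U] the
    products [U V] cancel. The path runs along the [x]-axis and then up the column. *)
Definition lelieuvre_grid (c : R) (U V : nat -> nat -> R) (i j : nat) : R :=
  c + partial_sum (fun i => U (S i) 0%nat * V i 0%nat - V (S i) 0%nat * U i 0%nat) i
    + partial_sum (fun j => U i j * V i (S j) - V i j * U i (S j)) j.

Lemma lelieuvre_grid_2 c U V i j :
  lelieuvre_grid c U V i (S j) - lelieuvre_grid c U V i j =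
  U i j * V i (S j) - V i j * U i (S j).
Proof. unfold lelieuvre_grid; simpl; ring. Qed.

(** Discrete closedness. Put [[a, b] = a_U b_V - a_V b_U] for the pairs of values at the vertices of
    an elementary square. Right then up gives [[n10, n00] + [n10, n11]], up then right gives
    [[n00, n01] + [n11, n01]]; by the equation for [n11] both equal [A [n10, n01]]. *)
Lemma lelieuvre_grid_1 c (A U V : nat -> nat -> R) i j :
  (forall i j, U (S i) (S j) + U i j = A i j * (U (S i) j + U i (S j))) ->
  (forall i j, V (S i) (S j) + V i j = A i j * (V (S i) j + V i (S j))) ->
  lelieuvre_grid c U V (S i) j - lelieuvre_grid c U V i j =
  U (S i) j * V i j - V (S i) j * U i j.
Proof.
  intros HU HV; induction j as [|j IH].
  - unfold lelieuvre_grid; simpl; ring.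
  - replace (lelieuvre_grid c U V (S i) (S j)) with
      (lelieuvre_grid c U V (S i) j + (U (S i) j * V (S i) (S j) - V (S i) j * U (S i) (S j)))
      by (pose proof (lelieuvre_grid_2 c U V (S i) j); lra).
    replace (lelieuvre_grid c U V i (S j)) with
      (lelieuvre_grid c U V i j + (U i j * V i (S j) - V i j * U i (S j)))
      by (pose proof (lelieuvre_grid_2 c U V i j); lra).
    assert (EU : U (S i) (S j) = A i j * (U (S i) j + U i (S j)) - U i j) by (rewrite <- HU; ring).
    assert (EV : V (S i) (S j) = A i j * (V (S i) j + V i (S j)) - V i j) by (rewrite <- HV; ring).
    rewrite EU, EV; lra.
Qed.

(** Lattice functions have real arguments, so the natural index is recovered by an integer part,
    which is exact at the nodes. *)
Definition grid_index (eps x : R) : nat := Z.to_nat (Int_part (x / eps)).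

Lemma grid_index_eq eps i : 0 < eps -> grid_index eps (eps * INR i) = i.
Proof.
  intros H; unfold grid_index.
  replace (eps * INR i / eps) with (INR i) by (field; lra).
  rewrite <- (Int_part_spec (INR i) (Z.of_nat i)) by (rewrite <- INR_IZR_INZ; lra).
  apply Nat2Z.id.
Qed.

Lemma in_grid_nat eps r x y : 0 < eps -> in_grid eps r x y ->
  exists i j, x = eps * INR i /\ y = eps * INR j /\ dom r 0 0 eps i j.
Proof.
  intros He ((i & j & Ex & Ey) & [Hx Hy]).
  assert (P : forall z, 0 <= eps * IZR z -> IZR z = INR (Z.to_nat z)).
  { intros z Hz; rewrite INR_IZR_INZ, Z2Nat.id; auto.
    apply le_IZR, (Rmult_le_reg_l eps); lra. }
  exists (Z.to_nat i), (Z.to_nat j).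
  rewrite <- !P by lra; repeat split; auto; rewrite Nat.add_0_r, <- P; lra.
Qed.

Lemma grid_succ eps i : eps * INR i + eps = eps * INR (S i).
Proof. rewrite S_INR; ring. Qed.

Lemma in_grid_of_nat eps r i j : dom r 0 0 eps i j -> in_grid eps r (eps * INR i) (eps * INR j).
Proof.
  intros (Hp & Hi & Hj); rewrite Nat.add_0_r in Hi, Hj; split.
  - exists (Z.of_nat i), (Z.of_nat j); rewrite <- !INR_IZR_INZ; auto.
  - split; (split; [apply Rmult_le_pos; [lra | apply pos_INR] | auto]).
Qed.

Lemma discrete_surface_exists n1 n2 q r eps f0 : 0 < eps -> n1 0 = n2 0 ->
  exists fe, canonical_discrete_A_surface n1 n2 q r eps fe /\ fe 0 0 = f0.
Proof.
  intros He h0.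
  set (A := fun i j => 1 + / 2 * eps ^ 2 * q (eps * INR i) (eps * INR j)).
  set (N := fun crd : vec3 -> R => moutard_grid A (fun i => crd (n1 (eps * INR i)))
              (fun j => crd (n2 (eps * INR j)))).
  set (G := fun (crd crd' : vec3 -> R) c => lelieuvre_grid c (N crd) (N crd')).
  set (ne := fun x y => let i := grid_index eps x in let j := grid_index eps y in
               mkvec (N crd1 i j) (N crd2 i j) (N crd3 i j)).
  set (fe := fun x y => let i := grid_index eps x in let j := grid_index eps y in
               mkvec (G crd2 crd3 (crd1 f0) i j) (G crd3 crd1 (crd2 f0) i j)
                     (G crd1 crd2 (crd3 f0) i j)).
  assert (Ene : forall i j, ne (eps * INR i) (eps * INR j) =
                  mkvec (N crd1 i j) (N crd2 i j) (N crd3 i j)).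
  { intros i j; unfold ne; rewrite !grid_index_eq; auto. }
  assert (Efe : forall i j, fe (eps * INR i) (eps * INR j) =
     mkvec (G crd2 crd3 (crd1 f0) i j) (G crd3 crd1 (crd2 f0) i j) (G crd1 crd2 (crd3 f0) i j)).
  { intros i j; unfold fe; rewrite !grid_index_eq; auto. }
  assert (NE : forall crd i j, N crd (S i) (S j) + N crd i j =
                 A i j * (N crd (S i) j + N crd i (S j))).
  { intros; apply moutard_grid_eq. }
  assert (z : 0 = eps * INR 0) by (simpl; ring).
  exists fe; split; [exists ne; split; [split; [|split]|split]|].
  - intros x y Hg _; destruct (in_grid_nat _ _ _ _ He Hg) as (i & j & -> & -> & _).
    unfold tau1, tau2; rewrite !grid_succ, !Ene.
    apply vec_ext; apply NE.
  - intros x Hg; destruct (in_grid_nat _ _ _ _ He Hg) as (i & j & -> & _ & _).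
    rewrite z, Ene.
    apply vec_ext; (apply moutard_grid_axis; rewrite <- z, h0; reflexivity).
  - intros y Hg; destruct (in_grid_nat _ _ _ _ He Hg) as (i & j & _ & -> & _).
    rewrite z, Ene; apply vec_ext; reflexivity.
  - intros x y Hg _; destruct (in_grid_nat _ _ _ _ He Hg) as (i & j & -> & -> & _).
    unfold delta1, tau1; rewrite !grid_succ, !Ene, !Efe.
    assert (L : forall crd crd' c, / eps * (G crd crd' c (S i) j - G crd crd' c i j) =
      / eps * (N crd (S i) j - N crd i j) * N crd' i j -
      / eps * (N crd' (S i) j - N crd' i j) * N crd i j).
    { intros crd crd' c; unfold G; rewrite (lelieuvre_grid_1 c A) by apply NE; ring. }
    apply vec_ext; apply L.
  - intros x y Hg _; destruct (in_grid_nat _ _ _ _ He Hg) as (i & j & -> & -> & _).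
    unfold delta2, tau2; rewrite !grid_succ, !Ene, !Efe.
    assert (L : forall crd crd' c, / eps * (G crd crd' c i (S j) - G crd crd' c i j) =
      N crd i j * (/ eps * (N crd' i (S j) - N crd' i j)) -
      N crd' i j * (/ eps * (N crd i (S j) - N crd i j))).
    { intros crd crd' c; unfold G; rewrite lelieuvre_grid_2; ring. }
    apply vec_ext; apply L.
  - rewrite z, Efe; unfold G, lelieuvre_grid.
    apply vec_ext; unfold mkvec, crd1, crd2, crd3; simpl; ring.
Qed.

(** * Passage between vector-valued surfaces and coordinate families *)

Lemma delta_crd (crd : vec3 -> R) (g : R -> R -> vec3) (W : gridfam) eps a b :
  (forall k u v, crd (scal k (minus u v)) = k * (crd u - crd v)) ->
  (forall i j, crd (g (eps * INR i) (eps * INR j)) = W eps i j) ->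
  forall i j, crd (delta eps a b g (eps * INR i) (eps * INR j)) =
    Nat.iter a FD1 (Nat.iter b FD2 W) eps i j.
Proof.
  intros L H; unfold delta.
  assert (B : forall i j, crd (Nat.iter b (delta2 eps) g (eps * INR i) (eps * INR j)) =
            Nat.iter b FD2 W eps i j).
  { induction b as [|b IH]; simpl; auto.
    intros i j; unfold delta2 at 1, tau2; rewrite L, grid_succ, !IH; reflexivity. }
  induction a as [|a IH]; simpl; auto.
  intros i j; unfold delta1 at 1, tau1; rewrite L, grid_succ, !IH; reflexivity.
Qed.

(** Equality on the square passes to derivatives along a segment at its inner points, which is what
    [potential_unique] asks for. *)
Lemma lelieuvre_potential_unique (u v u' v' F F' : R -> R -> R) r :
  smooth_R2 F -> smooth_R2 F' ->
  (forall x y, in_square r x y -> u x y = u' x y) ->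
  (forall x y, in_square r x y -> v x y = v' x y) ->
  (forall x y, in_square r x y -> dx F x y = dx u x y * v x y - dx v x y * u x y) ->
  (forall x y, in_square r x y -> dy F x y = u x y * dy v x y - v x y * dy u x y) ->
  (forall x y, in_square r x y -> dx F' x y = dx u' x y * v' x y - dx v' x y * u' x y) ->
  (forall x y, in_square r x y -> dy F' x y = u' x y * dy v' x y - v' x y * dy u' x y) ->
  F 0 0 = F' 0 0 -> forall x y, in_square r x y -> F x y = F' x y.
Proof.
  intros HF HF' Eu Ev X Y X' Y' E0.
  apply potential_unique; auto.
  - intros x y Hx Hy.
    assert (Sq : in_square r x y) by (split; lra).
    rewrite X, X', Eu, Ev by auto.
    replace (dx u' x y) with (dx u x y); [replace (dx v' x y) with (dx v x y); [ring|]|];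
      (apply (Derive_local_eq _ _ r); auto; intros s Hs; [apply Ev || apply Eu]; split; auto).
  - intros y Hy.
    assert (Sq : in_square r 0 y) by (split; lra).
    rewrite Y, Y', Eu, Ev by auto.
    replace (dy u' 0 y) with (dy u 0 y); [replace (dy v' 0 y) with (dy v 0 y); [ring|]|];
      (apply (Derive_local_eq _ _ r); auto; intros s Hs; [apply Ev || apply Eu]; split; auto; lra).
Qed.


Definition nodes (crd : vec3 -> R) (g : R -> R -> R -> vec3) : gridfam :=
  fun eps i j => crd (g eps (eps * INR i) (eps * INR j)).

Lemma dom_shift r p q eps i j a b : dom r (a + p) (b + q) eps i j ->
  dom r p q eps (a + i) (b + j).
Proof.
  intros (H & Hi & Hj); unfold dom.
  replace (a + i + p)%nat with (i + (a + p))%nat by lia.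
  replace (b + j + q)%nat with (j + (b + q))%nat by lia.
  auto.
Qed.

(** The Moutard equation is linear with a scalar coefficient, so an arbitrary linear coordinate
    [crd] serves for all three. *)
Lemma moutard_component_convergence (crd : vec3 -> R) n1 n2 q r K u (ne : R -> R -> R -> vec3) :
  (forall v w, crd (plus v w) = crd v + crd w) ->
  (forall k v, crd (scal k v) = k * crd v) ->
  smooth_R2 q -> smooth_R2 u -> (forall x y, dx (dy u) x y = q x y * u x y) ->
  (forall x, u x 0 = crd (n1 x)) -> (forall y, u 0 y = crd (n2 y)) ->
  0 <= K -> r <= / 4 -> K * r <= 1 ->
  (forall x y, in_square r x y -> Rabs (q x y) <= K) ->
  (forall eps, 0 < eps -> discrete_Moutard_normal n1 n2 q r eps (ne eps)) ->
  forall N, bnd r N 1 0 0 (fun eps i j => nodes crd ne eps i j - smp u eps i j).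
Proof.
  intros Lp Ls Hq Hu E U1 U2 HK Hr HKr Q H.
  assert (z : forall eps, eps * INR 0 = 0) by (intros; simpl; ring).
  apply (moutard_convergence r q u K); auto.
  - intros eps i j D; pose proof D as (Hp & _).
    destruct (H eps Hp) as (M & _ & _).
    specialize (M (eps * INR i) (eps * INR j)); rewrite !grid_succ in M.
    specialize (M (in_grid_of_nat _ _ _ _ (dom_le r 1 1 0 0 eps i j i j D ltac:(lia) ltac:(lia)))).
    specialize (M (in_grid_of_nat _ _ _ _ (dom_shift r 0 0 eps i j 1 1 D))).
    apply (f_equal crd) in M; rewrite Ls, !Lp in M; unfold tau1, tau2 in M.
    rewrite !grid_succ in M; exact M.
  - intros eps i D; pose proof D as (Hp & _).
    destruct (H eps Hp) as (_ & M & _).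
    unfold nodes, smp; rewrite z, M, U1; auto.
    rewrite <- (z eps); apply in_grid_of_nat, D.
  - intros eps j D; pose proof D as (Hp & _).
    destruct (H eps Hp) as (_ & _ & M).
    unfold nodes, smp; rewrite z, M, U2; auto.
    rewrite <- (z eps); apply in_grid_of_nat, D.
Qed.

(** The three coordinates stand for a cyclic permutation, as in the coordinate formula of the cross
    product. *)
Lemma lelieuvre_component_convergence (crd crd' crd'' : vec3 -> R) r u v F
    (ne fe : R -> R -> R -> vec3) :
  (forall k v w, crd (scal k (minus v w)) = k * (crd v - crd w)) ->
  (forall k v w, crd' (scal k (minus v w)) = k * (crd' v - crd' w)) ->
  (forall k v w, crd'' (scal k (minus v w)) = k * (crd'' v - crd'' w)) ->
  (forall v w, crd'' (cross v w) = crd v * crd' w - crd' v * crd w) ->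
  smooth_R2 u -> smooth_R2 v -> smooth_R2 F ->
  dx F = (fun x y => dx u x y * v x y - dx v x y * u x y) ->
  dy F = (fun x y => u x y * dy v x y - v x y * dy u x y) ->
  (forall N, bnd r N 1 0 0 (fun eps i j => nodes crd ne eps i j - smp u eps i j)) ->
  (forall N, bnd r N 1 0 0 (fun eps i j => nodes crd' ne eps i j - smp v eps i j)) ->
  (forall eps, 0 < eps -> discrete_Lelieuvre r eps (ne eps) (fe eps)) ->
  (forall eps, 0 < eps -> crd'' (fe eps 0 0) = F 0 0) ->
  forall N, bnd r N 1 0 0 (fun eps i j => nodes crd'' fe eps i j - smp F eps i j).
Proof.
  intros L1 L2 L3 LC Hu Hv HF EX EY BU BV H H0.
  apply (potential_convergence r u v F (nodes crd ne) (nodes crd' ne)); auto.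
  - intros eps i j D; pose proof D as (Hp & _).
    destruct (H eps Hp) as (M & _).
    specialize (M (eps * INR i) (eps * INR j)); rewrite !grid_succ in M.
    specialize (M (in_grid_of_nat _ _ _ _ (dom_le r 1 0 0 0 eps i j i j D ltac:(lia) ltac:(lia)))).
    specialize (M (in_grid_of_nat _ _ _ _ (dom_shift r 0 0 eps i j 1 0 D))).
    apply (f_equal crd'') in M; rewrite LC in M; unfold delta1, tau1 in M.
    rewrite L1, L2, L3, !grid_succ in M; exact M.
  - intros eps i j D; pose proof D as (Hp & _).
    destruct (H eps Hp) as (_ & M).
    specialize (M (eps * INR i) (eps * INR j)); rewrite !grid_succ in M.
    specialize (M (in_grid_of_nat _ _ _ _ (dom_le r 0 1 0 0 eps i j i j D ltac:(lia) ltac:(lia)))).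
    specialize (M (in_grid_of_nat _ _ _ _ (dom_shift r 0 0 eps i j 0 1 D))).
    apply (f_equal crd'') in M; rewrite LC in M; unfold delta2, tau2 in M.
    rewrite L1, L2, L3, !grid_succ in M; exact M.
  - intros eps Hp; unfold nodes; simpl; rewrite !Rmult_0_r; auto.
Qed.

Lemma converges_of_components r (fe : R -> R -> R -> vec3) (f : R -> R -> vec3) :
  (forall N, bnd r N 1 0 0 (fun eps i j => nodes crd1 fe eps i j - smp (fun x y => crd1 (f x y)) eps i j)) ->
  (forall N, bnd r N 1 0 0 (fun eps i j => nodes crd2 fe eps i j - smp (fun x y => crd2 (f x y)) eps i j)) ->
  (forall N, bnd r N 1 0 0 (fun eps i j => nodes crd3 fe eps i j - smp (fun x y => crd3 (f x y)) eps i j)) ->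
  converges_smoothly_order_eps r fe f.
Proof.
  intros B1 B2 B3 a b.
  destruct (bnd_iter r 1 _ a b 0 0 (B1 (a + b)%nat)) as (c1 & e1 & He1 & K1).
  destruct (bnd_iter r 1 _ a b 0 0 (B2 (a + b)%nat)) as (c2 & e2 & He2 & K2).
  destruct (bnd_iter r 1 _ a b 0 0 (B3 (a + b)%nat)) as (c3 & e3 & He3 & K3).
  exists (c1 + c2 + c3), (Rmin e1 (Rmin e2 e3)); split; [repeat apply Rmin_pos; auto|].
  intros eps [Hp Hs] x y Hg [_ [Hx' Hy']].
  destruct (in_grid_nat _ _ _ _ Hp Hg) as (i & j & -> & -> & _).
  assert (D : dom r (0 + a) (0 + b) eps i j).
  { unfold dom; rewrite !Nat.add_0_l, !plus_INR; repeat split; lra. }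
  pose proof (Rmin_l e1 (Rmin e2 e3)); pose proof (Rmin_r e1 (Rmin e2 e3)).
  pose proof (Rmin_l e2 e3); pose proof (Rmin_r e2 e3).
  specialize (K1 eps i j ltac:(lra) D); specialize (K2 eps i j ltac:(lra) D);
    specialize (K3 eps i j ltac:(lra) D).
  eapply Rle_trans; [apply norm_vec_le|].
  rewrite <- (delta_crd crd1 (fun s t => minus (fe eps s t) (f s t))) in K1 by reflexivity.
  rewrite <- (delta_crd crd2 (fun s t => minus (fe eps s t) (f s t))) in K2 by reflexivity.
  rewrite <- (delta_crd crd3 (fun s t => minus (fe eps s t) (f s t))) in K3 by reflexivity.
  rewrite pow_1 in K1, K2, K3; lra.
Qed.

Theorem theorem3p14 (n1 n2 : R -> vec3) (q12 : R -> R -> R) (f0 : vec3)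
    (hn1 : smooth_curve n1) (hn2 : smooth_curve n2) (h0 : n1 0 = n2 0)
    (hq12 : smooth_R2 q12) :
  exists r : R, 0 < r /\
  (* the A-surface with data (A), normalized at the origin, exists ... *)
  exists f : R -> R -> vec3,
    (A_surface_with_data n1 n2 q12 r f /\ f 0 0 = f0) /\
    (* ... and is unique on B(r) *)
    (forall g : R -> R -> vec3,
       A_surface_with_data n1 n2 q12 r g -> g 0 0 = f0 ->
       forall x y : R, in_square r x y -> g x y = f x y) /\
    (* the normalized canonical discrete A-surfaces exist ... *)
    (forall eps : R, 0 < eps ->
       exists fe : R -> R -> vec3,
         canonical_discrete_A_surface n1 n2 q12 r eps fe /\ fe 0 0 = f0) /\
    (* ... and converge to f *)
    (forall fe : R -> R -> R -> vec3,
       (forall eps : R, 0 < eps ->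
          canonical_discrete_A_surface n1 n2 q12 r eps (fe eps) /\
          fe eps 0 0 = f0) ->
       converges_smoothly_order_eps r fe f).
Proof.
  destruct hn1 as (a1 & a2 & a3), hn2 as (b1 & b2 & b3).
  destruct (goursat_exists _ _ q12 a1 b1 (f_equal crd1 h0) hq12) as (u1 & S1 & E1 & A1 & B1).
  destruct (goursat_exists _ _ q12 a2 b2 (f_equal crd2 h0) hq12) as (u2 & S2 & E2 & A2 & B2).
  destruct (goursat_exists _ _ q12 a3 b3 (f_equal crd3 h0) hq12) as (u3 & S3 & E3 & A3 & B3).
  (* Each coordinate of the surface comes from the other two of the normal, in cyclic order, and
     starts at that of [f0]. *)
  destruct (lelieuvre_potential q12 u2 u3 (crd1 f0) S2 S3 E2 E3) as (F1 & T1 & X1 & Y1 & Z1).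
  destruct (lelieuvre_potential q12 u3 u1 (crd2 f0) S3 S1 E3 E1) as (F2 & T2 & X2 & Y2 & Z2).
  destruct (lelieuvre_potential q12 u1 u2 (crd3 f0) S1 S2 E1 E2) as (F3 & T3 & X3 & Y3 & Z3).
  destruct (C0_bounded q12 0 1 (smooth_C0 _ hq12)) as (K & HK & Q).
  (* The bound [K] is taken on the unit square, before [r] is chosen. The number 1/4 serves the
     discrete Gronwall estimate; the second term gives [K r <= 1/2] for the halving argument and
     hence the [K r <= 1] of the discrete one. Adding 1 to [K] keeps the denominator positive. *)
  set (r := Rmin (/ 4) (/ (2 * (K + 1)))).
  assert (Hr : 0 < r <= / 4).
  { split; [apply Rmin_pos; [lra | apply Rinv_0_lt_compat; lra] | apply Rmin_l]. }
  assert (HKr : K * r <= / 2).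
  { apply Rle_trans with ((K + 1) * / (2 * (K + 1))); [|right; field; lra].
    apply Rmult_le_compat; try lra; apply Rmin_r. }
  assert (Qr : forall x y, in_square r x y -> Rabs (q12 x y) <= K).
  { intros x y [Hx Hy]; apply Q; lra. }
  set (n := fun x y => mkvec (u1 x y) (u2 x y) (u3 x y)).
  set (f := fun x y => mkvec (F1 x y) (F2 x y) (F3 x y)).
  assert (P1 : forall x y, partial1 f x y = cross (partial1 n x y) (n x y)).
  { intros x y; apply vec_ext;
      [apply (f_equal (fun h => h x y) X1) | apply (f_equal (fun h => h x y) X2)
      | apply (f_equal (fun h => h x y) X3)]. }
  assert (P2 : forall x y, partial2 f x y = cross (n x y) (partial2 n x y)).
  { intros x y; apply vec_ext;
      [apply (f_equal (fun h => h x y) Y1) | apply (f_equal (fun h => h x y) Y2)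
      | apply (f_equal (fun h => h x y) Y3)]. }
  assert (P11 : forall x y, partial1 (partial1 f) x y =
     cross (partial1 (partial1 n) x y) (n x y)).
  { intros x y; apply vec_ext;
      [change (dx (dx F1) x y = dx (dx u2) x y * u3 x y - dx (dx u3) x y * u2 x y); rewrite X1
      |change (dx (dx F2) x y = dx (dx u3) x y * u1 x y - dx (dx u1) x y * u3 x y); rewrite X2
      |change (dx (dx F3) x y = dx (dx u1) x y * u2 x y - dx (dx u2) x y * u1 x y); rewrite X3];
      apply dx_wronskian; auto. }
  assert (P22 : forall x y, partial2 (partial2 f) x y =
     cross (n x y) (partial2 (partial2 n) x y)).
  { intros x y; apply vec_ext;
      [change (dy (dy F1) x y = u2 x y * dy (dy u3) x y - u3 x y * dy (dy u2) x y); rewrite Y1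
      |change (dy (dy F2) x y = u3 x y * dy (dy u1) x y - u1 x y * dy (dy u3) x y); rewrite Y2
      |change (dy (dy F3) x y = u1 x y * dy (dy u2) x y - u2 x y * dy (dy u1) x y); rewrite Y3];
      apply dy_wronskian; auto. }
  exists r; split; [lra|]; exists f; split; [split; [split|]|split; [|split]].
  - split; [repeat split; assumption|].
    intros x y _; rewrite P11, P22, P1, P2; intros H; split;
      [apply (in_span_asymptotic _ _ _ (partial1 (partial1 n) x y) H)
      |apply (in_span_asymptotic _ _ _ (partial2 (partial2 n) x y) H)].
  - exists n; split; [split; [repeat split; assumption|split; [|split]]|split; auto].
    + intros x y _; apply vec_ext; [apply E1 | apply E2 | apply E3].
    + intros x _; apply vec_ext; [apply A1 | apply A2 | apply A3].
    + intros y _; apply vec_ext; [apply B1 | apply B2 | apply B3].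
  - apply vec_ext; assumption.
  - intros g (((Sg1 & Sg2 & Sg3) & _) & n' & ((Sn1 & Sn2 & Sn3) & M & N1 & N2) & L) g0.
    (* The normal of the competing surface is pinned down on the square coordinate by coordinate;
       the normalization at the origin then fixes its potential. *)
    assert (W1 : forall x y, in_square r x y -> crd1 (n' x y) = u1 x y).
    { apply (goursat_unique q12 (fun x y => crd1 (n' x y)) u1 r K); auto; try lra.
      - intros x y Sq; apply (f_equal crd1 (M x y Sq)).
      - intros x Hx; rewrite N1, A1; auto.
      - intros y Hy; rewrite N2, B1; auto. }
    assert (W2 : forall x y, in_square r x y -> crd2 (n' x y) = u2 x y).
    { apply (goursat_unique q12 (fun x y => crd2 (n' x y)) u2 r K); auto; try lra.
      - intros x y Sq; apply (f_equal crd2 (M x y Sq)).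
      - intros x Hx; rewrite N1, A2; auto.
      - intros y Hy; rewrite N2, B2; auto. }
    assert (W3 : forall x y, in_square r x y -> crd3 (n' x y) = u3 x y).
    { apply (goursat_unique q12 (fun x y => crd3 (n' x y)) u3 r K); auto; try lra.
      - intros x y Sq; apply (f_equal crd3 (M x y Sq)).
      - intros x Hx; rewrite N1, A3; auto.
      - intros y Hy; rewrite N2, B3; auto. }
    intros x y Sq; apply vec_ext.
    + apply (lelieuvre_potential_unique (fun x y => crd2 (n' x y)) (fun x y => crd3 (n' x y))
        u2 u3 (fun x y => crd1 (g x y)) F1 r); auto.
      * intros s t St; apply (f_equal crd1 (proj1 (L s t St))).
      * intros s t St; apply (f_equal crd1 (proj2 (L s t St))).
      * intros s t _; rewrite X1; reflexivity.
      * intros s t _; rewrite Y1; reflexivity.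
      * rewrite g0, Z1; reflexivity.
    + apply (lelieuvre_potential_unique (fun x y => crd3 (n' x y)) (fun x y => crd1 (n' x y))
        u3 u1 (fun x y => crd2 (g x y)) F2 r); auto.
      * intros s t St; apply (f_equal crd2 (proj1 (L s t St))).
      * intros s t St; apply (f_equal crd2 (proj2 (L s t St))).
      * intros s t _; rewrite X2; reflexivity.
      * intros s t _; rewrite Y2; reflexivity.
      * rewrite g0, Z2; reflexivity.
    + apply (lelieuvre_potential_unique (fun x y => crd1 (n' x y)) (fun x y => crd2 (n' x y))
        u1 u2 (fun x y => crd3 (g x y)) F3 r); auto.
      * intros s t St; apply (f_equal crd3 (proj1 (L s t St))).
      * intros s t St; apply (f_equal crd3 (proj2 (L s t St))).
      * intros s t _; rewrite X3; reflexivity.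
      * intros s t _; rewrite Y3; reflexivity.
      * rewrite g0, Z3; reflexivity.
  - intros eps He; apply discrete_surface_exists; auto.
  - intros fe H.
    (* Each discrete surface comes with some normal field; they are collected into one family so
       that the uniform estimates apply. For [eps <= 0] the zero field is a placeholder. *)
    destruct (choice (fun eps ne => 0 < eps ->
      discrete_Moutard_normal n1 n2 q12 r eps ne /\ discrete_Lelieuvre r eps ne (fe eps)))
      as [ne Hne].
    { intros eps; destruct (Rlt_dec 0 eps) as [Hp|Hp].
      - destruct (H eps Hp) as [[ne Hn] _]; exists ne; auto.
      - exists (fun _ _ => zero); intros; contradiction. }
    assert (HM : forall eps, 0 < eps -> discrete_Moutard_normal n1 n2 q12 r eps (ne eps))
      by (intros; apply Hne; auto).
    assert (HL : forall eps, 0 < eps -> discrete_Lelieuvre r eps (ne eps) (fe eps))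
      by (intros; apply Hne; auto).
    assert (V1 := moutard_component_convergence crd1 n1 n2 q12 r K u1 ne
      (fun _ _ => eq_refl) (fun _ _ => eq_refl) hq12 S1 E1 A1 B1 HK (proj2 Hr) ltac:(lra) Qr HM).
    assert (V2 := moutard_component_convergence crd2 n1 n2 q12 r K u2 ne
      (fun _ _ => eq_refl) (fun _ _ => eq_refl) hq12 S2 E2 A2 B2 HK (proj2 Hr) ltac:(lra) Qr HM).
    assert (V3 := moutard_component_convergence crd3 n1 n2 q12 r K u3 ne
      (fun _ _ => eq_refl) (fun _ _ => eq_refl) hq12 S3 E3 A3 B3 HK (proj2 Hr) ltac:(lra) Qr HM).
    apply converges_of_components;
      [apply (lelieuvre_component_convergence crd2 crd3 crd1 r u2 u3 F1 ne fe)
      |apply (lelieuvre_component_convergence crd3 crd1 crd2 r u3 u1 F2 ne fe)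
      |apply (lelieuvre_component_convergence crd1 crd2 crd3 r u1 u2 F3 ne fe)];
      try reflexivity; auto; intros eps Hp; rewrite (proj2 (H eps Hp)); auto.
Qed.
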